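(* Let $H$ be a complex Hilbert space with $\dim H\geq 3$, and let $\mathcal{P}(H)$ be the set of all projections on $H$. Let $\phi :\mathcal{P}(H)\rightarrow\mathcal{P}(H)$ be a bijective map with the property that \[ P \leq Q \Longleftrightarrow \phi(P)\leq \phi(Q) \qquad (P,Q \in \mathcal{P}(H)) \] and suppose that there are states $D$, $D'$ on $H$ such that $D$ is not a scalar operator and \[ \operatorname{tr}(\phi(P)D')=\operatorname{tr}(PD) \qquad (P \in \mathcal{P}(H)). \] Then there exists an either unitary or antiunitary operator $U$ on $H$ such that $\phi$ is of the form \[ \phi(P)=UPU^{*} \qquad (P \in \mathcal{P}(H)). \]
   Context: The space $H$ may be finite- or infinite-dimensional. A projection on $H$ is a bounded self-adjoint idempotent linear operator (orthogonal projection onto a closed subspace); $\mathcal{P}(H)$ denotes the set of all projections. The relation $\leq$ is the usual order among self-adjoint bounded operators ($P\leq Q$ iff $Q-P$ is positive, i.e. positive semidefinite), restricted to $\mathcal{P}(H)$; for projections it is equivalent to inclusion of ranges. A (mixed) state on $H$ is a positive trace-class operator on $H$ with trace $1$; $\operatorname{tr}$ is the usual trace functional. A scalar operator is an operator of the form $\lambda I$ with $\lambda\in\mathbb{C}$, where $I$ is the identity operator. An antiunitary operator is a conjugate-linear bijection $U$ of $H$ preserving the norm; its adjoint $U^*$ is $U^{-1}$. *)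

(* Defs.v *)
From HB Require Import structures.
From mathcomp Require Import all_boot all_order all_algebra.
From mathcomp Require Import finmap complex.
From mathcomp Require Import all_classical all_reals all_analysis.

Set Implicit Arguments.
Unset Strict Implicit.
Unset Printing Implicit Defensive.

Import Order.TTheory GRing.Theory Num.Theory Num.Def.
Import numFieldNormedType.Exports.

Local Open Scope classical_set_scope.
Local Open Scope complex_scope.
Local Open Scope ring_scope.

(* The inner product is linear in its first argument and conjugate-linear in  *)
(* the second; it induces the norm for which the space is complete.           *)
HB.mixin Record NormedModule_isHilbert (R : realType) (H : Type)
    & CompleteNormedModule R[i] H := {
  inner : {dot H for @conjC R[i]};
  sqr_norm_inner : forall x : H, `|x| ^+ 2 = inner x x
}.

#[short(type="hilbertType")]
HB.structure Definition Hilbert (R : realType) :=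
  {H of NormedModule_isHilbert R H & CompleteNormedModule R[i] H}.

Notation "''[' u , v ]" := (inner u v) : ring_scope.

Section HilbertSpace.
Context {R : realType} {H : hilbertType R}.
Implicit Types (T S A P Q U V : H -> H) (E F : set H).

Definition dim_ge (n : nat) := exists v : 'I_n -> H,
  forall c : 'I_n -> R[i], \sum_i c i *: v i = 0 -> forall i, c i = 0.

Definition orthonormal_set E :=
  (forall e, E e -> '[e, e] = 1) /\
  (forall e f, E e -> E f -> e <> f -> '[e, f] = 0).

(* An orthonormal basis is a maximal orthonormal set. *)
Definition orthonormal_basis E :=
  orthonormal_set E /\ forall F, E `<` F -> ~ orthonormal_set F.

Lemma ex_orthonormal_basis : exists E, orthonormal_basis E.
Proof.
apply: Zorn_bigcup => C Con totC; split.
  by move=> e [E CE Ee]; have [nE _] := Con E CE; exact: nE.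
move=> e f [E CE Ee] [F CF Ff]; have [EF|FE] := totC E F CE CF.
  by have [_ oF] := Con F CF; apply: oF => //; exact: EF.
by have [_ oE] := Con E CE; apply: oE => //; exact: FE.
Qed.

Definition hilbert_basis : set H := projT1 (cid ex_orthonormal_basis).

Lemma hilbert_basisP : orthonormal_basis hilbert_basis.
Proof. exact: projT2 (cid ex_orthonormal_basis). Qed.

Definition bounded_operator T :=
  linear T /\ exists M : R[i], forall x, `|T x| <= M * `|x|.

Definition adjoint_pair T S := forall x y, '[T x, y] = '[x, S y].

Definition positive_operator T :=
  bounded_operator T /\ forall x, 0 <= '[T x, x].

Definition operator_le S T := positive_operator (fun x => T x - S x).

Definition scalar_operator T := exists a : R[i], forall x, T x = a *: x.

(* A = |T|, i.e. A is the positive square root of T^* T *)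
Definition is_absolute_value T A :=
  positive_operator A /\ forall x y, '[A (A x), y] = '[T x, T y].

Definition trace_class T :=
  bounded_operator T /\ exists2 A, is_absolute_value T A &
    (\esum_(e in hilbert_basis) (complex.Re '[A e, e])%:E < +oo)%E.

(* sections of the directed set of finite subsets of E *)
Definition finite_subsets E : set_system {fset H} :=
  filter_from [set X : {fset H} | [set` X] `<=` E]
    (fun X => [set Y : {fset H} | [set` X] `<=` [set` Y] /\ [set` Y] `<=` E]).

(* Unordered sum of the diagonal entries; for a trace-class T it converges    *)
(* and does not depend on the orthonormal basis.                              *)
Definition trace T : R[i] :=
  lim ((fun X : {fset H} => \sum_(e <- X) '[T e, e] : R[i]^o)
         @ finite_subsets hilbert_basis).

Definition state D :=
  [/\ positive_operator D, trace_class D & trace D = 1].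

Definition is_projection P :=
  [/\ bounded_operator P, adjoint_pair P P & P \o P = P].

(* V is the adjoint of U. *)
Definition unitary U V :=
  [/\ bounded_operator U, adjoint_pair U V, cancel U V & cancel V U].

(* V = U^-1 plays the role of the adjoint of U. *)
Definition antiunitary U V :=
  [/\ linear_for (@conjC R[i] \; *:%R) U, forall x, `|U x| = `|x|,
      cancel U V & cancel V U].

End HilbertSpace.

Arguments dim_ge {R} H n.
Arguments hilbert_basis {R} H.

Record projection (R : realType) (H : hilbertType R) := Projection {
  projection_op :> H -> H;
  projectionP : is_projection projection_op
}.

Lemma projection_eqP (R : realType) (H : hilbertType R) (P Q : projection H) :
  P = Q <-> P =1 Q.
Proof.
split=> [->//|/funext]; case: P Q => [p hp] [q hq] /= pq.
by rewrite pq in hp *; congr Projection; exact: Prop_irrelevance.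
Qed.

(* Main.v *)
From HB Require Import structures.
Require Import Defs.
From mathcomp Require Import all_boot all_order all_algebra.
From mathcomp Require Import finmap complex.
From mathcomp Require Import all_classical all_reals all_analysis.
From mathcomp Require Import ring lra.

Set Implicit Arguments.
Unset Strict Implicit.
Unset Printing Implicit Defensive.

Import Order.TTheory GRing.Theory Num.Theory Num.Def.
Import numFieldNormedType.Exports.

Local Open Scope classical_set_scope.
Local Open Scope complex_scope.
Local Open Scope ring_scope.

(** The statement splits into a projective part and a metric part.

    Projective part.  The rank-one projections are the minimal nonzero elements
    of the order, so [phi] permutes the lines of [H]; as the projection onto a
    plane is the supremum of two lines of that plane, [phi] sends the lines of a
    plane to the lines of a plane.  Such a collineation is induced by a
    semilinear map [T], with a ring endomorphism [s] of the scalars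
    ([fundamental_theorem_projective_geometry]); this uses dimension at least 3.
    At this stage [s] may be a wild automorphism, and [T] may distort angles.

    Metric part.  On the line of [x], the trace condition reads
    [<D' T x, T x> / <T x, T x> = <D x, x> / <x, x>] ([trace_rank1], through
    Parseval's identity).  As [D] is not scalar, this quotient is not constant;
    let [x], [y] have different values.  In the plane that they span, the form
    [<D x, y>] has orthonormal eigenvectors [u], [v], where the quotient has its
    maximum and its minimum.  The images [T u] and [T v] are the
    extrema of the corresponding quotient of [D'], and extrema of a quotient of
    hermitian forms with different values are orthogonal ([image_of_extremal]).
    Comparing the quotients at [u + k v] and at [T u + s(k) T v] then gives
    [|s k|^2 |T v|^2 = |k|^2 |T u|^2].  For [k = 1] this shows that [T] scales the
    whole plane by a constant, and then that [s] preserves moduli, so that [s] is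
    the identity or the conjugation ([isometric_endomorphism]).  The scaling
    factors agree for any two vectors with different quotients; two vectors with
    equal quotients are compared through a third vector, so [T] is a multiple of
    an isometry ([conformal_of_quotients]).

    Normalizing [T] gives [U].  Since [U] carries the range of [P] onto the range
    of [phi P] and preserves orthogonality, [phi P] is the conjugate of [P]. *)

(** * Planes and independent triples in a vector space *)

Section Spans.
Context {F : fieldType} {V : lmodType F}.
Implicit Types x y z u v w : V.

Definition comb3 x y z (a b c : F) := a *: x + b *: y + c *: z.

Definition in_span2 x y z := exists a b, x = a *: y + b *: z.

Definition indep3 x y z := forall a b c, comb3 x y z a b c = 0 ->
  [/\ a = 0, b = 0 & c = 0].

Lemma comb3D x y z a b c a' b' c' :
  comb3 x y z a b c + comb3 x y z a' b' c' =
  comb3 x y z (a + a') (b + b') (c + c').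
Proof.
by rewrite /comb3 addrACA [X in X + _]addrACA -!scalerDl.
Qed.

Lemma comb3Z x y z k a b c :
  k *: comb3 x y z a b c = comb3 x y z (k * a) (k * b) (k * c).
Proof. by rewrite /comb3 !scalerDr !scalerA. Qed.

Lemma comb3_1 x y z : x = comb3 x y z 1 0 0.
Proof. by rewrite /comb3 scale1r !scale0r !addr0. Qed.

Lemma comb3_2 x y z : y = comb3 x y z 0 1 0.
Proof. by rewrite /comb3 scale1r !scale0r addr0 add0r. Qed.

Lemma comb3_3 x y z : z = comb3 x y z 0 0 1.
Proof. by rewrite /comb3 scale1r !scale0r !add0r. Qed.

Lemma comb3_inj x y z a b c a' b' c' : indep3 x y z ->
  comb3 x y z a b c = comb3 x y z a' b' c' -> [/\ a = a', b = b' & c = c'].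
Proof.
move=> ind /eqP; rewrite -subr_eq0 -scaleN1r comb3Z comb3D => /eqP /ind.
by rewrite !mulN1r => -[/subr0_eq-> /subr0_eq-> /subr0_eq->].
Qed.

(** Computations in the span of three independent vectors amount to comparing
    coefficients.  The combination is returned as an opaque function, so that
    rewriting [x], [y], [z] into coordinates does not act inside it again. *)
Lemma indep3_frame x y z : indep3 x y z ->
  exists f : F -> F -> F -> V,
    [/\ f 1 0 0 = x /\ f 0 1 0 = y /\ f 0 0 1 = z,
        forall a b c a' b' c', f a b c + f a' b' c' = f (a + a') (b + b') (c + c'),
        forall k a b c, k *: f a b c = f (k * a) (k * b) (k * c)
      & forall a b c a' b' c', f a b c = f a' b' c' ->
          [/\ a = a', b = b' & c = c']].
Proof.
move=> ind; exists (comb3 x y z); split.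
- by rewrite -comb3_1 -comb3_2 -comb3_3.
- by move=> *; exact: comb3D.
- by move=> *; exact: comb3Z.
- by move=> a b c a' b' c'; exact: comb3_inj.
Qed.

Lemma in_span2_mem1 y z : in_span2 y y z.
Proof. by exists 1, 0; rewrite scale1r scale0r addr0. Qed.

Lemma in_span2_mem2 y z : in_span2 z y z.
Proof. by exists 0, 1; rewrite scale1r scale0r add0r. Qed.

Lemma in_span2D x x' y z : in_span2 x y z -> in_span2 x' y z ->
  in_span2 (x + x') y z.
Proof.
move=> [a [b ->]] [c [d ->]]; exists (a + c), (b + d).
by rewrite addrACA -!scalerDl.
Qed.

Lemma in_span2Z k x y z : in_span2 x y z -> in_span2 (k *: x) y z.
Proof.
by move=> [a [b ->]]; exists (k * a), (k * b); rewrite scalerDr !scalerA.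
Qed.

Lemma in_span2B x x' y z : in_span2 x y z -> in_span2 x' y z ->
  in_span2 (x - x') y z.
Proof. by move=> hx hx'; rewrite -scaleN1r; apply/in_span2D/in_span2Z. Qed.

Lemma in_span2Dr x y z w : in_span2 x z w -> in_span2 (x + y) z w ->
  in_span2 y z w.
Proof. by move=> hx h; rewrite -[y](addKr x) addrC; exact: in_span2B. Qed.

Lemma in_span2_diag x y : in_span2 x y y -> exists a, x = a *: y.
Proof. by move=> [a [b ->]]; exists (a + b); rewrite scalerDl. Qed.

Lemma in_span2_line a x z : in_span2 (a *: x) x z.
Proof. exact/in_span2Z/in_span2_mem1. Qed.

Lemma indep3I x y z : x <> 0 -> ~ in_span2 y x x -> ~ in_span2 z x y ->
  indep3 x y z.
Proof.
move=> x0 yx zxy a b c abc.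
have [c0|c0] := eqVneq c 0; last first.
  case: zxy; exists (- (a / c)), (- (b / c)).
  apply: (scalerI c0); rewrite scalerDr !scalerA.
  apply/eqP; rewrite -subr_eq0 -[X in _ == X]abc /comb3.
  have -> : c * - (a / c) = - a by field.
  have -> : c * - (b / c) = - b by field.
  by rewrite opprD !scaleNr !opprK addrC.
have [b0|b0] := eqVneq b 0; last first.
  case: yx; exists (- (a / b)), 0; rewrite scale0r addr0.
  apply: (scalerI b0); rewrite scalerA.
  have -> : b * - (a / b) = - a by field.
  move/eqP: abc; rewrite /comb3 c0 scale0r addr0 addrC addr_eq0 => /eqP ->.
  by rewrite scaleNr.
move/eqP: abc; rewrite /comb3 c0 b0 !scale0r !addr0 scaler_eq0.
by case/orP=> /eqP // a0; split.
Qed.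

End Spans.

(** * The fundamental theorem of projective geometry *)

Section Fundamental.
Context {F : fieldType} {V W : lmodType F}.
Variable p : V -> W.
Hypothesis p0 : p 0 = 0.
Hypothesis pP : forall x y z, in_span2 x y z <-> in_span2 (p x) (p y) (p z).
Hypothesis dim3 : forall x y : V, exists z, ~ in_span2 z x y.

Let p_eq0 x : p x = 0 -> x = 0.
Proof.
move=> px; have /pP : in_span2 (p x) (p 0) (p 0).
  by rewrite px p0; exists 0, 0; rewrite !scaler0 addr0.
by move=> [a [b ->]]; rewrite !scaler0 addr0.
Qed.

Section Base.
Variable e : V.
Hypothesis e0 : e <> 0.

Definition off x := ~ in_span2 x e e.

(** Representatives of the image lines are rescaled so as to become additive: the
    representative of the line of [p x] is the one whose sum with [p e] spans the
    line of [p (e + x)].  This makes sense for [x] off the line of [e]. *)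
Definition lift_spec x w :=
  (exists2 c, c != 0 & w = c *: p x) /\
  (exists2 d, d != 0 & p (e + x) = d *: (p e + w)).

Let p_indep x y : off x -> ~ in_span2 y e x -> indep3 (p e) (p x) (p y).
Proof.
by move=> ex exy; apply: indep3I => [/p_eq0//| /pP//| /pP//].
Qed.

Let off_next x : exists y, ~ in_span2 y e x.
Proof. exact: dim3. Qed.

Let lift_ex x : off x -> exists w, lift_spec x w.
Proof.
move=> ox; have [y exy] := off_next x.
have ind := p_indep ox exy.
have /pP : in_span2 (e + x) e x.
  exact: in_span2D (in_span2_mem1 _ _) (in_span2_mem2 _ _).
move=> [a [b ab]].
have a0 : a != 0.
  apply/eqP => a0; case: ox.
  have /pP : in_span2 (p (e + x)) (p x) (p x).
    by exists b, 0; rewrite ab a0 !scale0r add0r addr0.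
  case/in_span2_diag => k ek.
  have kk : e = (k - 1) *: x by rewrite scalerBl scale1r -ek addrK.
  have k1 : k - 1 != 0.
    by apply/eqP => k1; apply: e0; rewrite kk k1 scale0r.
  exists (k - 1)^-1, 0; rewrite scale0r addr0 kk scalerA mulVf ?scale1r //.
have b0 : b != 0.
  apply/eqP => b0; case: ox.
  have /pP : in_span2 (p (e + x)) (p e) (p e).
    by exists a, 0; rewrite ab b0 !scale0r !addr0.
  move=> h; rewrite -[x](addKr e) addrC; apply: in_span2B => //.
  exact: in_span2_mem1.
exists ((b / a) *: p x); split; first by exists (b / a); rewrite ?mulf_neq0 ?invr_eq0.
exists a => //; rewrite scalerDr scalerA ab.
by congr (_ + _ *: _); field.
Qed.

Definition lift x : W := xget 0 [set w | lift_spec x w].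

Let liftP x : off x -> lift_spec x (lift x).
Proof. by move=> /lift_ex[w hw]; rewrite /lift; case: xgetP => [y -> //|/(_ w)]. Qed.

Let lift_uniq x w : off x -> lift_spec x w -> w = lift x.
Proof.
move=> ox [[c c0 wE] [d d0 eq1]]; have [[c' c'0 wE'] [d' d'0 eq2]] := liftP ox.
have [y exy] := off_next x; have ind := p_indep ox exy.
have [f [[f1 [f2 f3]] fD fZ f_inj]] := indep3_frame ind.
move: eq2; rewrite eq1 wE wE' -f1 -f2 !(fZ, fD) => /f_inj[].
rewrite !mulr0 !addr0 !mulr1 !add0r => dd' dc _.
by rewrite -dd' in dc; rewrite (mulfI d0 dc).
Qed.

Let liftN0 x : off x -> lift x <> 0.
Proof.
move=> ox; have [[c c0 ->] _] := liftP ox.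
move=> /eqP; rewrite scaler_eq0 (negPf c0) /= => /eqP/p_eq0 x0.
by apply: ox; rewrite x0; exists 0, 0; rewrite !scale0r addr0.
Qed.

Let lift_indep x y : off x -> off y -> ~ in_span2 y e x ->
  indep3 (p e) (lift x) (lift y).
Proof.
move=> ox oy exy a b c.
have [[k k0 ->] _] := liftP ox; have [[l l0 ->] _] := liftP oy.
rewrite /comb3 !scalerA => /(p_indep ox exy)[-> /eqP + /eqP].
by rewrite !mulf_eq0 (negPf k0) (negPf l0) !orbF => /eqP -> /eqP ->.
Qed.

Let off_notin x y : ~ in_span2 y e x -> off y.
Proof.
by move=> exy /in_span2_diag [a ya]; apply: exy; rewrite ya; exact: in_span2_line.
Qed.

Let p_liftE x : off x -> exists2 c, c != 0 & p x = c *: lift x.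
Proof.
move=> /liftP[[c c0 ->] _]; exists c^-1; first by rewrite invr_eq0.
by rewrite scalerA mulVf // scale1r.
Qed.

Let off_add x y : ~ in_span2 y e x -> off (x + y).
Proof.
move=> exy /in_span2_diag[a h]; apply: exy.
by apply: (in_span2Dr (in_span2_mem2 _ _)); rewrite h; exact: in_span2_line.
Qed.

(** The line of [p (e + x + y)] is the intersection of the plane through
    [p (e + x)] and [p y] with the plane through [p (e + y)] and [p x], hence it
    is spanned by [p e + lift x + lift y]. *)
Let liftD_indep x y : off x -> ~ in_span2 y e x ->
  lift (x + y) = lift x + lift y.
Proof.
move=> ox exy; have oy := off_notin exy.
have oxy := off_add exy.
have ind := lift_indep ox oy exy.
have [f [[f1 [f2 f3]] fD fZ f_inj]] := indep3_frame ind.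
have [_ [d1 _ ex]] := liftP ox; have [_ [d2 _ ey]] := liftP oy.
have [c1 _ px] := p_liftE ox; have [c2 _ py] := p_liftE oy.
rewrite -f1 -f2 -f3 !(fZ, fD) in ex ey px py.
have /pP : in_span2 (e + (x + y)) (e + x) y.
  by exists 1, 1; rewrite !scale1r addrA.
move=> [a1 [b1 v1]]; rewrite ex py !(fZ, fD) in v1.
have /pP : in_span2 (e + (x + y)) (e + y) x.
  by exists 1, 1; rewrite !scale1r -addrA [y + x]addrC.
move=> [a2 [b2]]; rewrite v1 ey px !(fZ, fD) => /f_inj[].
have /pP : in_span2 (x + y) x y by exists 1, 1; rewrite !scale1r.
move=> [a3 [b3 u]]; rewrite px py !(fZ, fD) in u.
have /pP : in_span2 (e + (x + y)) e (x + y) by exists 1, 1; rewrite !scale1r.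
move=> [a4 [b4]]; rewrite v1 u -f1 !(fZ, fD) => /f_inj[].
rewrite !(mulr0, mulr1, addr0, add0r) in v1 u * => E1 E2 E3 E4 E5 E6.
(* The equations say that [p (e + (x + y))] is a1 d1 times
   [p e + lift x + lift y]. *)
have v0 : a1 * d1 != 0.
  have f0 : f 0 0 0 = 0 by rewrite -(scale0r (f 0 0 0)) fZ !mul0r.
  apply/eqP => h; have : p (e + (x + y)) = 0 by rewrite v1 E6 -E4 h f0.
  move=> /p_eq0 /eqP; rewrite addrC addr_eq0 => /eqP h'; apply: oxy; rewrite h'.
  by exists (-1), 0; rewrite scaleN1r scale0r addr0.
have b40 : b4 != 0 by apply/eqP => h; case/eqP: v0; rewrite E2 h mul0r.
set g := a1 * d1 / b4.
have g0 : g != 0 by rewrite mulf_neq0 // invr_eq0.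
have uE : p (x + y) = g *: (lift x + lift y).
  rewrite u -f2 -f3 !(fZ, fD) /g; congr f; first by ring.
    by rewrite E2; field.
  by rewrite E4 -E6 E3; field.
apply/esym/lift_uniq => //; split.
  by exists g^-1; rewrite ?invr_eq0 // uE scalerA mulVf // scale1r.
exists (a1 * d1) => //.
rewrite v1 -f1 -f2 -f3 !(fZ, fD) E6 -E4; congr f; ring.
Qed.

Let notin_scale k x y : k != 0 -> ~ in_span2 y e x -> ~ in_span2 y e (k *: x).
Proof.
by move=> k0 exy [a [b yE]]; apply: exy; exists a, (b * k); rewrite -scalerA.
Qed.

Let notin_span x y z : ~ in_span2 y e x -> in_span2 z e x -> ~ in_span2 y e z.
Proof.
move=> exy [a [b ->]] [c [d yE]]; apply: exy; exists (c + d * a), (d * b).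
by rewrite yE scalerDr !scalerA addrA -scalerDl.
Qed.

(** If [y] lies in the plane of [e] and [x], the sum is compared with the sums
    obtained by adding a vector [z] outside of this plane. *)
Let liftD x y : off x -> off y -> off (x + y) -> lift (x + y) = lift x + lift y.
Proof.
move=> ox oy oxy; have [exy|exy] := pselect (in_span2 y e x); last exact: liftD_indep.
have [z exz] := off_next x.
have exyz : in_span2 (x + y) e x by apply: in_span2D => //; exact: in_span2_mem2.
have exz' := notin_span exz exyz; have exz'' := notin_span exz exy.
have exyz' : ~ in_span2 (y + z) e x.
  by move=> h; apply: exz; apply: in_span2Dr h.
apply: (addIr (lift z)); rewrite -(liftD_indep oxy exz').
by rewrite -!addrA -(liftD_indep oy exz'') (liftD_indep ox exyz').
Qed.

Let off_scale k x : k != 0 -> off x -> off (k *: x).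
Proof.
move=> k0 ox h; apply: ox; rewrite -[x](scalerK k0); exact: in_span2Z.
Qed.

Let lift_scale k x : k != 0 -> off x -> exists c, lift (k *: x) = c *: lift x.
Proof.
move=> k0 ox; have [[c c0 ->] _] := liftP (off_scale k0 ox).
have /pP : in_span2 (k *: x) x x by exact: in_span2_line.
move=> /in_span2_diag[d ->]; have [b _ ->] := p_liftE ox.
by exists (c * (d * b)); rewrite !scalerA mulrA.
Qed.

Let off_ex : exists x, off x.
Proof. exact: dim3. Qed.

(** The factor by which [lift] responds to a scalar; it is the same for all
    vectors off the line of [e]. *)
Definition twist k : F := if k == 0 then 0
  else xget 0 [set c | forall x, off x -> lift (k *: x) = c *: lift x].

(** Both factors equal the factor of [x + y], by additivity. *)
Let lift_scale_indep k c c' x y : k != 0 -> off x -> ~ in_span2 y e x ->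
  lift (k *: x) = c *: lift x -> lift (k *: y) = c' *: lift y -> c = c'.
Proof.
move=> k0 ox exy kx ky; have oy := off_notin exy.
have oxy := off_add exy.
have [d] := lift_scale k0 oxy.
have kexy : ~ in_span2 (k *: y) e (k *: x).
  apply: notin_scale => // h; apply: exy; rewrite -[y](scalerK k0).
  exact: in_span2Z.
rewrite scalerDr (liftD_indep (off_scale k0 ox) kexy).
rewrite kx ky liftD_indep // => h.
have := comb3_inj (lift_indep ox oy exy) (a := 0) (b := c) (c := c')
  (a' := 0) (b' := d) (c' := d).
by rewrite /comb3 scale0r !add0r h scalerDr => /(_ erefl)[_ -> ->].
Qed.

Let liftZ k x : k != 0 -> off x -> lift (k *: x) = twist k *: lift x.
Proof.
move=> k0; rewrite /twist (negPf k0); move: x.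
case: xgetP => // /(_ _) H; have [x ox] := off_ex.
have [c xc] := lift_scale k0 ox; case: (H c) => y oy /=.
have [c' yc] := lift_scale k0 oy; rewrite yc.
have [exy|exy] := pselect (in_span2 y e x); last first.
  by rewrite (lift_scale_indep k0 ox exy xc yc).
have [z exz] := off_next x; have [c'' zc] := lift_scale k0 (off_notin exz).
rewrite (lift_scale_indep k0 ox exz xc zc).
by rewrite (lift_scale_indep k0 oy (notin_span exz exy) yc zc).
Qed.

Let lift_cancel x a b : off x -> a *: lift x = b *: lift x -> a = b.
Proof.
move=> ox /eqP; rewrite -subr_eq0 -scalerBl scaler_eq0 subr_eq0.
by case/orP=> /eqP // /(liftN0 ox).
Qed.

Let twist0 : twist 0 = 0. Proof. by rewrite /twist eqxx. Qed.

Let twist1 : twist 1 = 1.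
Proof.
have [x ox] := off_ex; apply: (lift_cancel ox).
by rewrite -liftZ ?oner_neq0 // !scale1r.
Qed.

Let twistM : {morph twist : k l / k * l}.
Proof.
move=> k l; have [->|k0] := eqVneq k 0; first by rewrite mul0r twist0 mul0r.
have [->|l0] := eqVneq l 0; first by rewrite mulr0 twist0 mulr0.
have [x ox] := off_ex; apply: (lift_cancel ox).
rewrite -liftZ ?mulf_neq0 // -scalerA liftZ //; last exact: off_scale.
by rewrite liftZ // scalerA.
Qed.

Let liftZ_add k x y : off x -> ~ in_span2 y e x ->
  lift (k *: x + y) = twist k *: lift x + lift y.
Proof.
move=> ox exy; have [->|k0] := eqVneq k 0.
  by rewrite twist0 !scale0r !add0r.
rewrite liftD_indep ?liftZ //; first exact: off_scale.
exact: notin_scale.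
Qed.

(** The vector [y] outside of the plane of [e] and [x] makes the additivity of
    [lift] on independent triples available for the multiples of [x]. *)
Let twistD : {morph twist : k l / k + l}.
Proof.
move=> k l; have [x ox] := off_ex; have [y exy] := off_next x.
apply: (lift_cancel ox); apply: (addIr (lift y)).
rewrite -liftZ_add // !scalerDl -addrA liftZ_add ?liftZ_add ?addrA //.
move=> h; apply: exy; apply: (in_span2Dr _ h).
exact/in_span2Z/in_span2_mem2.
Qed.

Let off_span x : off x \/ exists a, x = a *: e.
Proof. by have [/in_span2_diag|] := pselect (in_span2 x e e); [right|left]. Qed.

Let off_eD k x : off x -> off (k *: e + x).
Proof. by move=> ox h; apply/ox/(in_span2Dr _ h)/in_span2_line. Qed.

(** Adding a third independent vector [y] forces the proportionality factor
    between the two sides to be 1. *)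
Let lift_e1 x : off x -> lift (e + x) = p e + lift x.
Proof.
move=> ox; have oex : off (e + x) by rewrite -[e]scale1r; exact: off_eD.
have [c cex] : exists c, lift (e + x) = c *: (p e + lift x).
  have [[a _ ->] _] := liftP oex; have [_ [b _ ->]] := liftP ox.
  by exists (a * b); rewrite scalerA.
have [y exy] := off_next x; have oy := off_notin exy.
have exxy : in_span2 (e + x) e x.
  exact: in_span2D (in_span2_mem1 _ _) (in_span2_mem2 _ _).
have oxy := off_add exy.
have oexy : off (e + (x + y)) by rewrite -[e]scale1r; exact: off_eD.
have [c' cexy] : exists c, lift (e + (x + y)) = c *: (p e + lift (x + y)).
  have [[a _ ->] _] := liftP oexy; have [_ [b _ ->]] := liftP oxy.
  by exists (a * b); rewrite scalerA.
move: cexy; rewrite addrA (liftD_indep oex (notin_span exy exxy)).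
rewrite cex (liftD_indep ox exy) => h.
have := comb3_inj (lift_indep ox oy exy) (a := c) (b := c) (c := 1)
  (a' := c') (b' := c') (c' := c').
rewrite /comb3 -!scalerDr scale1r h addrA => /(_ erefl)[-> _ <-].
by rewrite scale1r.
Qed.

(** The values on the line of [e] are forced by [lift_e1] and semilinearity. *)
Definition extension x : W :=
  if pselect (off x) is left _ then lift x
  else twist (xget 0 [set a | x = a *: e]) *: p e.

Let extension_off x : off x -> extension x = lift x.
Proof. by move=> ox; rewrite /extension; case: pselect. Qed.

Let extension_e a : extension (a *: e) = twist a *: p e.
Proof.
rewrite /extension; case: pselect => [[]|_]; first exact: in_span2_line.
case: xgetP => [b _ /eqP|/(_ a)/(_ erefl)//]; rewrite -subr_eq0 -scalerBl scaler_eq0.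
by rewrite subr_eq0 => /orP[/eqP->|/eqP].
Qed.

Let extension_eD a x : off x ->
  extension (a *: e + x) = extension (a *: e) + extension x.
Proof.
move=> ox; rewrite (extension_off (@off_eD a x ox)) (extension_off ox) extension_e.
have [->|a0] := eqVneq a 0; first by rewrite twist0 !scale0r !add0r.
have ox' : off (a^-1 *: x) by apply: off_scale; rewrite ?invr_eq0.
rewrite -{1}[x](scalerKV a0) -scalerDr liftZ //; last first.
  by rewrite -[e]scale1r; exact: off_eD.
by rewrite lift_e1 // scalerDr -liftZ // scalerKV.
Qed.

Let extensionN x : extension (- x) = - extension x.
Proof.
have tN : twist (-1) = -1.
  by apply/eqP; rewrite -subr_eq0 opprK -{2}twist1 -twistD addNr twist0.
have N10 : -1 != 0 :> F by rewrite oppr_eq0 oner_neq0.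
have [ox|[a ->]] := off_span x; last first.
  by rewrite -scaleNr !extension_e -mulN1r twistM tN mulN1r scaleNr.
rewrite -scaleN1r !extension_off //; last exact: off_scale.
by rewrite liftZ // tN scaleN1r.
Qed.

Let extensionD : {morph extension : x y / x + y}.
Proof.
move=> x y; have [ox|[a ->]] := off_span x; last first.
  have [oy|[b ->]] := off_span y; first exact: extension_eD.
  by rewrite -scalerDl !extension_e twistD scalerDl.
have [oy|[b ->]] := off_span y; last first.
  by rewrite addrC extension_eD // addrC.
have [oxy|[c xyE]] := off_span (x + y).
  by rewrite !extension_off // liftD.
rewrite xyE -[y](addKr x) xyE [- x + _]addrC extension_eD.
  by rewrite extensionN addrCA subrr addr0.
by rewrite -scaleN1r; apply: off_scale; rewrite // oppr_eq0 oner_neq0.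
Qed.

Let extensionZ k x : extension (k *: x) = twist k *: extension x.
Proof.
have [ox|[a ->]] := off_span x; last first.
  by rewrite scalerA !extension_e twistM scalerA.
have [->|k0] := eqVneq k 0; last first.
  by rewrite !extension_off ?liftZ //; exact: off_scale.
by rewrite scale0r -(scale0r e) extension_e twist0 !scale0r.
Qed.

Let extension_p x : exists2 c, c != 0 & extension x = c *: p x.
Proof.
have [ox|[a ->]] := off_span x.
  by rewrite extension_off //; case: (liftP ox).
rewrite extension_e.
have [a0|a0] := eqVneq a 0.
  by exists 1; rewrite ?oner_neq0 // a0 twist0 !scale0r p0 scaler0.
have ta : twist a != 0.
  apply/eqP => ta; have /eqP := oner_neq0 F; apply.
  by rewrite -twist1 -(mulfV a0) twistM ta mul0r.
have /pP/in_span2_diag[c pc] : in_span2 (a *: e) e e by exact: in_span2_line.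
have c0 : c != 0.
  apply/eqP => c0; move: pc; rewrite c0 scale0r => /p_eq0/eqP.
  by rewrite scaler_eq0 (negPf a0) => /eqP.
exists (twist a / c); first by rewrite mulf_neq0 ?invr_eq0.
by rewrite pc scalerA divfK.
Qed.

Lemma semilinear_extension : exists (T : V -> W) (s : F -> F),
  [/\ {morph s : k l / k + l}, {morph s : k l / k * l} & s 1 = 1] /\
  [/\ {morph T : x y / x + y}, forall k x, T (k *: x) = s k *: T x
    & forall x, exists2 c, c != 0 & T x = c *: p x].
Proof. by exists extension, twist. Qed.

End Base.

(** The map [p] chooses a vector on the image of each line; only the lines
    matter, so [T] agrees with [p] up to nonzero factors. *)
Theorem fundamental_theorem_projective_geometry :
  exists (T : V -> W) (s : F -> F),
  [/\ {morph s : k l / k + l}, {morph s : k l / k * l} & s 1 = 1] /\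
  [/\ {morph T : x y / x + y}, forall k x, T (k *: x) = s k *: T x
    & forall x, exists2 c, c != 0 & T x = c *: p x].
Proof.
have [e e0] := dim3 0 0; apply: (@semilinear_extension e) => eE.
by apply: e0; rewrite eE; exact: in_span2_mem1.
Qed.

End Fundamental.

(** * Hermitian forms *)

Definition hermitian_form (C : numClosedFieldType) (V : lmodType C)
    (G : V -> V -> C) :=
  [/\ forall x y z, G (x + y) z = G x z + G y z,
      forall a x y, G (a *: x) y = a * G x y
    & forall x y, G x y = (G y x)^*].

Section HermitianForms.
Context {C : numClosedFieldType} {V : lmodType C}.
Variable G : V -> V -> C.

Section Theory.
Hypothesis hG : hermitian_form G.

Lemma hformDl x y z : G (x + y) z = G x z + G y z.
Proof. by case: hG. Qed.

Lemma hformZl a x y : G (a *: x) y = a * G x y.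
Proof. by case: hG. Qed.

Lemma hformC x y : G x y = (G y x)^*.
Proof. by case: hG. Qed.

Lemma hformDr x y z : G x (y + z) = G x y + G x z.
Proof. by rewrite hformC hformDl rmorphD /= -!hformC. Qed.

Lemma hformZr a x y : G x (a *: y) = a^* * G x y.
Proof. by rewrite hformC hformZl rmorphM /= -hformC. Qed.

Lemma hform_real x : G x x \is Num.real.
Proof. by rewrite CrealE -hformC. Qed.

Lemma hform_comb a b x y : G (a *: x + b *: y) (a *: x + b *: y) =
  `|a| ^+ 2 * G x x + `|b| ^+ 2 * G y y + (a * b^* * G x y + (a * b^* * G x y)^*).
Proof.
rewrite hformDl !hformDr !hformZl !hformZr !rmorphM /= conjCK -hformC !normCK.
ring.
Qed.

Lemma hform_comb_diag a b x y : G x y = 0 ->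
  G (a *: x + b *: y) (a *: x + b *: y) = `|a| ^+ 2 * G x x + `|b| ^+ 2 * G y y.
Proof. by move=> xy; rewrite hform_comb xy mulr0 rmorph0 !addr0. Qed.

(** A vector at which a positive semidefinite form vanishes is in its kernel:
    otherwise the form would be negative at some [k x + y]. *)
Lemma psd_null x y : (forall z, in_span2 z x y -> 0 <= G z z) -> G x x = 0 ->
  G x y = 0.
Proof.
move=> psd x0; apply/eqP/negPn/negP => g0.
have c0 : 0 <= G y y by apply/psd/in_span2_mem2.
have n0 : 0 < `|G x y| ^+ 2 by rewrite exprn_gt0 // normr_gt0.
(* With [k = - m conj (G x y)], the value at [k x + y] is
   [G y y - 2 m |G x y|^2]; this [m] makes it [- (G y y + 2)]. *)
pose m := (G y y + 1) / (`|G x y| ^+ 2).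
have m0 : m^* = m.
  by apply/CrealP/ger0_real; rewrite divr_ge0 ?addr_ge0 ?ler01 // ltW.
have := psd (- (m * (G x y)^*) *: x + 1 *: y) (ex_intro _ _ (ex_intro _ _ erefl)).
rewrite hform_comb x0 mulr0 add0r.
rewrite normr1 expr1n mul1r conjC1 mulr1.
have -> : - (m * (G x y)^*) * G x y = - (G y y + 1).
  by rewrite mulNr -mulrA [_^* * _]mulrC -normCK divfK // gt_eqF.
rewrite rmorphN rmorphD /= rmorph1 -hformC.
have -> : G y y + (- (G y y + 1) - (G y y + 1)) = - (G y y + 1 + 1) by ring.
by rewrite oppr_ge0 lt_geF // !ltr_wpDl ?ltr01 ?addr_ge0 ?ler01.
Qed.

End Theory.

(** Polarization.  The form is not assumed to be hermitian: the lemma serves to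
    prove that some forms are. *)
Lemma sesquilinear_eq0 (B : V -> V -> C) :
  (forall x y z, B (x + y) z = B x z + B y z) ->
  (forall x y z, B x (y + z) = B x y + B x z) ->
  (forall a x y, B (a *: x) y = a * B x y) ->
  (forall a x y, B x (a *: y) = a^* * B x y) ->
  (forall x, B x x = 0) -> forall x y, B x y = 0.
Proof.
move=> BDl BDr BZl BZr B0 x y.
have E1 : B x y + B y x = 0.
  by have := B0 (x + y); rewrite BDl !BDr !B0 addr0 add0r.
have E2 : B x y - B y x = 0.
  have := B0 (x + 'i *: y).
  rewrite BDl !BDr !BZl !BZr !B0 !mulr0 addr0 add0r conjCi mulNr.
  move=> h; apply/eqP; rewrite -(mulrI_eq0 _ (mulfI (neq0Ci C))) mulrBr.
  by rewrite -opprB oppr_eq0 addrC h.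
have : 2 * B x y = 0.
  transitivity ((B x y + B y x) + (B x y - B y x)); first by ring.
  by rewrite E1 E2 addr0.
by move/eqP; rewrite mulf_eq0 pnatr_eq0 => /eqP.
Qed.

End HermitianForms.

Section InnerProduct.
Context {C : numClosedFieldType} {V : lmodType C} (form : {dot V for conjC}).
Local Notation "''[' u , v ]" := (form u%R v%R) : ring_scope.
Local Notation "''[' u ]" := '[u, u]%R : ring_scope.
Implicit Types (x y z u v : V) (G : V -> V -> C).

Lemma dot_hermitian_form : hermitian_form form.
Proof.
split=> [x y z|a x y|x y]; first exact: linearDl.
  exact: linearZl_LR.
by rewrite hermC mul1r.
Qed.

Lemma dotC x y : '[x, y] = ('[y, x])^*.
Proof. exact: (hformC dot_hermitian_form). Qed.

Lemma dot0l x : '[0, x] = 0. Proof. exact: linear0l. Qed.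

Lemma dot0r x : '[x, 0] = 0. Proof. exact: linear0r. Qed.

Lemma dotZl a x y : '[a *: x, y] = a * '[x, y].
Proof. exact: (hformZl dot_hermitian_form). Qed.

Lemma dotZr a x y : '[x, a *: y] = a^* * '[x, y].
Proof. exact: (hformZr dot_hermitian_form). Qed.

Lemma hform_shift G a : a \is Num.real -> hermitian_form G ->
  hermitian_form (fun x y => a * '[x, y] - G x y).
Proof.
move=> /CrealP ar hG; split=> [x y z|k x y|x y].
- by rewrite linearDl /= (hformDl hG); ring.
- by rewrite dotZl /= (hformZl hG); ring.
- rewrite rmorphB rmorphM /= ar -(hformC hG).
  by rewrite -(hformC dot_hermitian_form).
Qed.

Lemma cauchy_schwarz x y : `|'[x, y]| ^+ 2 <= '[x] * '[y].
Proof.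
have [->|y0] := eqVneq y 0; first by rewrite !dot0r normr0 expr0n mulr0.
have n0 : 0 < '[y] by rewrite dnorm_gt0.
have := dnorm_ge0 form (x - ('[x, y] / '[y]) *: y).
rewrite linearBl /= !linearBr /= !dotZl !dotZr.
rewrite rmorphM fmorphV /= -dotC -[('[y])^*]dotC.
rewrite (_ : _ - _ = '[x] - '[x, y] * '[y, x] / '[y]); last by field; rewrite gt_eqF.
by rewrite [in X in _ -> X]normCK -dotC subr_ge0 ler_pdivrMr.
Qed.

Definition orthonormal2 u v := [/\ '[u] = 1, '[v] = 1 & '[u, v] = 0].

Lemma normalize x : x != 0 -> '[(sqrtC '[x])^-1 *: x] = 1.
Proof.
move=> x0; rewrite dnormZ normfV exprVn ger0_norm ?sqrt_dnorm_ge0 // sqrtCK.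
by rewrite mulVf // dnorm_eq0.
Qed.

Lemma gram_schmidt x y : x != 0 -> ~ in_span2 y x x ->
  exists u v, [/\ orthonormal2 u v, in_span2 x u v & in_span2 y u v].
Proof.
move=> x0 yx; pose z := y - ('[y, x] / '[x]) *: x.
have z0 : z != 0.
  rewrite subr_eq0; apply/eqP => yE; apply: yx; rewrite yE.
  exact: in_span2_line.
have xz : '[x, z] = 0.
  by rewrite dotC linearBl /= dotZl /= divfK ?dnorm_eq0 // subrr rmorph0.
exists ((sqrtC '[x])^-1 *: x), ((sqrtC '[z])^-1 *: z); split.
- split; try exact: normalize.
  by rewrite dotZl dotZr /= xz !mulr0.
- by exists (sqrtC '[x]), 0; rewrite scale0r addr0 scalerKV // sqrt_dnorm_eq0.
- exists ('[y, x] / '[x] * sqrtC '[x]), (sqrtC '[z]).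
  rewrite scalerKV ?sqrt_dnorm_eq0 // -scalerA scalerKV ?sqrt_dnorm_eq0 //.
  by rewrite addrC subrK.
Qed.

(** Diagonalization of a 2 by 2 hermitian matrix by a unitary matrix with rows
    proportional to [(a, b)] and [(- conj b, conj a)]. *)
Lemma diagonalize G u v : hermitian_form G -> orthonormal2 u v ->
  exists u' v',
    [/\ orthonormal2 u' v', G u' v' = 0, in_span2 u u' v' & in_span2 v u' v'].
Proof.
move=> hG [uu vv uv]; have [r0|r0] := eqVneq (G u v) 0.
  exists u, v; split=> //; [exact: in_span2_mem1|exact: in_span2_mem2].
have [a aE] : exists a, a = (G u v)^* by exists (G u v)^*.
pose d := G v v - G u u.
(* [(a, b)] is an eigenvector when [b] solves this quadratic equation, obtained
   from the characteristic equation by the shift [b = t - G u u]. *)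
have [b bE] : exists b, b ^+ 2 - d * b - G u v * a = 0.
  exists ((d + sqrtC (d ^+ 2 + 4 * (G u v * a))) / 2).
  move: (G u v * a) => r; have := sqrtCK (d ^+ 2 + 4 * r).
  set w := sqrtC _; clearbody w => wE.
  transitivity ((w ^+ 2 - d ^+ 2 - 4 * r) / 4); first by field.
  by rewrite wE; field.
have vu : '[v, u] = 0 by rewrite dotC uv rmorph0.
pose n := `|a| ^+ 2 + `|b| ^+ 2.
have n0 : 0 < n.
  by rewrite ltr_pwDl ?exprn_ge0 // exprn_gt0 // normr_gt0 aE conjC_eq0.
have nE : n = a * a^* + b * b^* by rewrite /n !normCK.
pose k := (sqrtC n)^-1.
have kE : k ^+ 2 = n^-1 by rewrite exprVn sqrtCK.
have kr : k^* = k.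
  by apply/CrealP/ger0_real; rewrite invr_ge0 sqrtC_ge0 ltW.
have kk : k * k = n^-1 by rewrite -expr2.
exists ((k * a) *: u + (k * b) *: v), ((- (k * b^*)) *: u + (k * a^*) *: v).
have hd := dot_hermitian_form.
split; first split.
- rewrite (hform_comb_diag hd) // uu vv !mulr1 !normCK !rmorphM /= kr.
  rewrite (_ : _ + _ = (k * k) * n); first by rewrite kk mulVf // gt_eqF.
  by rewrite nE; ring.
- rewrite (hform_comb_diag hd) // uu vv !mulr1 !normCK rmorphN !rmorphM /= kr !conjCK.
  rewrite (_ : _ + _ = (k * k) * n); first by rewrite kk mulVf // gt_eqF.
  by rewrite nE; ring.
- rewrite (hformDl hd) !(hformDr hd) !(hformZl hd) !(hformZr hd) uu vv uv vu.
  by rewrite rmorphN !rmorphM /= kr !conjCK; ring.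
- rewrite (hformDl hG) !(hformDr hG) !(hformZl hG) !(hformZr hG).
  rewrite rmorphN !rmorphM /= kr !conjCK [G v u](hformC hG) -aE.
  transitivity (- (k * k * a * (b ^+ 2 - d * b - G u v * a))).
    by rewrite /d; ring.
  by rewrite bE mulr0 oppr0.
- exists (k * a^*), (- (k * b)).
  rewrite !scalerDr !scalerA addrACA -!scalerDl.
  have -> : k * a^* * (k * a) + - (k * b) * - (k * b^*) = 1.
    by rewrite -(mulVf (lt0r_neq0 n0)) -kk nE; ring.
  by rewrite (_ : (_ + _)%R = 0 :> C) ?scale0r ?scale1r ?addr0 //; ring.
- exists (k * b^*), (k * a).
  rewrite !scalerDr !scalerA addrACA -!scalerDl.
  have -> : k * b^* * (k * b) + k * a * (k * a^*) = 1.
    by rewrite -(mulVf (lt0r_neq0 n0)) -kk nE; ring.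
  by rewrite (_ : (_ + _)%R = 0 :> C) ?scale0r ?scale1r ?add0r //; ring.
Qed.

End InnerProduct.

(** * Maps that preserve the quotient of two hermitian forms *)

(** Lets [ring] derive an equation from another one. *)
Lemma eq_by_sub (C : zmodType) (a b c d : C) : c = d -> a - b = c - d -> a = b.
Proof. by move=> ->; rewrite subrr => /subr0_eq. Qed.

(** Preserving moduli means preserving the real part of [k (conj l)].  With [l = 1]
    this fixes real parts; [s 'i] is a square root of -1, and with [l = 'i]
    imaginary parts are fixed or negated accordingly. *)
Lemma isometric_endomorphism (C : numClosedFieldType) (s : C -> C) :
  {morph s : k l / k + l} -> {morph s : k l / k * l} -> s 1 = 1 ->
  (forall k, `|s k| = `|k|) -> (forall k, s k = k) \/ (forall k, s k = k^*).
Proof.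
move=> sD sM s1 sn.
have s0 : s 0 = 0 by apply: (addrI (s 0)); rewrite -sD !addr0.
have sN k : s (- k) = - s k.
  by apply/eqP; rewrite -addr_eq0 -sD addNr s0.
have polar k l : s k * (s l)^* + (s k * (s l)^*)^* = k * l^* + (k * l^*)^*.
  have n x : s x * (s x)^* = x * x^* by rewrite -!normCK sn.
  have := n (k + l); rewrite sD !rmorphD /= !mulrDl !mulrDr !n.
  by rewrite !rmorphM /= !conjCK => E; apply: (eq_by_sub E); ring.
have re k : s k + (s k)^* = k + k^*.
  by have := polar k 1; rewrite s1 conjC1 !mulr1.
have im k : s k * (s 'i)^* + (s k * (s 'i)^*)^* = - 'i * (k - k^*).
  by rewrite polar rmorphM /= conjCK conjCi; ring.
have si2 : (s 'i - 'i) * (s 'i + 'i) = 0.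
  rewrite mulrDr !mulrBl -sM -!expr2 sqrCi sN s1.
  by rewrite ['i * s 'i]mulrC; ring.
have i0 := neq0Ci C.
have two0 : 2 != 0 :> C by rewrite pnatr_eq0.
move/eqP: si2; rewrite mulf_eq0 subr_eq0 addr_eq0 => /orP[]/eqP si; [left|right] => k.
  have := im k; rewrite si rmorphM /= conjCK conjCi => E.
  have {}E : s k - (s k)^* = k - k^*.
    by apply: (mulfI i0); apply: oppr_inj; rewrite -[RHS]mulNr -E; ring.
  by apply: (mulfI two0); apply: (eq_by_sub (congr2 +%R (re k) E)); ring.
have := im k; rewrite si rmorphM /= rmorphN /= conjCi opprK conjCi => E.
have {}E : s k - (s k)^* = - (k - k^*).
  by apply: (mulfI i0); rewrite mulrN -mulNr -E; ring.
by apply: (mulfI two0); apply: (eq_by_sub (congr2 +%R (re k) E)); ring.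
Qed.

Section Extremal.
Context {C : numClosedFieldType} {V W : lmodType C}.
Variables (nV : {dot V for conjC}) (nW : {dot W for conjC}).
Variables (G : V -> V -> C) (G' : W -> W -> C) (T : V -> W).
Hypothesis hG' : hermitian_form G'.
Hypothesis TD : {morph T : x y / x + y}.
Hypothesis T_plane : forall z x y, in_span2 z (T x) (T y) ->
  exists2 w, in_span2 w x y & exists k, z = k *: T w.
Hypothesis GT : forall x, G x x * nW (T x) (T x) = G' (T x) (T x) * nV x x.

Let T0 : T 0 = 0.
Proof. by apply: (addrI (T 0)); rewrite -TD !addr0. Qed.

Let nV_neq0 x : x != 0 -> nV x x != 0.
Proof. by rewrite dnorm_eq0. Qed.

Let transfer_le (c : C) x y : c \is Num.real ->
  (forall w, in_span2 w x y -> 0 <= c * nV w w - G w w) ->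
  forall z, in_span2 z (T x) (T y) -> 0 <= c * nW z z - G' z z.
Proof.
move=> cr h z /T_plane[w wxy [k ->]].
rewrite (hformZl hG') (hformZr hG') dotZl dotZr /=.
rewrite (_ : _ - _ = `|k| ^+ 2 * (c * nW (T w) (T w) - G' (T w) (T w))); last first.
  by rewrite normCK; ring.
rewrite mulr_ge0 ?exprn_ge0 //.
have [->|w0] := eqVneq w 0.
  by rewrite T0 dot0l -(scale0r (0 : W)) (hformZl hG') mul0r mulr0 subr0.
have w1 : 0 < nV w w by rewrite dnorm_gt0.
rewrite -(pmulr_lge0 _ w1) mulrBl -GT.
by rewrite mulrAC -mulrBl mulr_ge0 // h.
Qed.

(** If [c] bounds the quotient of [G] on the plane of [u] and [v] and is attained
    at [u], the same holds for [G'] on the image plane.  Then [c nW - G'] is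
    positive semidefinite there and vanishes at [T u]. *)
Lemma image_of_extremal (c : C) u v : c \is Num.real ->
  (forall w, in_span2 w u v -> 0 <= c * nV w w - G w w) -> G u u = c * nV u u ->
  u != 0 -> G' (T u) (T v) = c * nW (T u) (T v).
Proof.
move=> cr h uE u0; apply/esym/eqP; rewrite -subr_eq0; apply/eqP.
apply: (psd_null (G := fun x y => c * nW x y - G' x y)).
- exact: hform_shift.
- exact: transfer_le.
apply/eqP; rewrite subr_eq0; apply/eqP/(mulIf (nV_neq0 u0)).
by rewrite -GT uE mulrAC.
Qed.

End Extremal.

Lemma hform_opp (C : numClosedFieldType) (V : lmodType C) (G : V -> V -> C) :
  hermitian_form G -> hermitian_form (fun x y => - G x y).
Proof.
move=> hG; split=> [x y z|k x y|x y].
- by rewrite (hformDl hG) opprD.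
- by rewrite (hformZl hG) mulrN.
- by rewrite rmorphN /= -(hformC hG).
Qed.

Section Plane.
Context {C : numClosedFieldType} {V W : lmodType C}.
Variables (nV : {dot V for conjC}) (nW : {dot W for conjC}).
Variables (G : V -> V -> C) (G' : W -> W -> C) (T : V -> W) (s : C -> C).
Hypotheses (hG : hermitian_form G) (hG' : hermitian_form G').
Hypotheses (TD : {morph T : x y / x + y}) (TZ : forall k x, T (k *: x) = s k *: T x).
Hypothesis s1 : s 1 = 1.
Hypothesis T_plane : forall z x y, in_span2 z (T x) (T y) ->
  exists2 w, in_span2 w x y & exists k, z = k *: T w.
Hypothesis T_eq0 : forall x, T x = 0 -> x = 0.
Hypothesis GT : forall x, G x x * nW (T x) (T x) = G' (T x) (T x) * nV x x.

Let orthonormal_neq0 u : nV u u = 1 -> u != 0.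
Proof. by rewrite -(dnorm_eq0 nV) => ->; rewrite oner_eq0. Qed.

Let comb_norm u v a b : orthonormal2 nV u v ->
  nV (a *: u + b *: v) (a *: u + b *: v) = `|a| ^+ 2 + `|b| ^+ 2.
Proof.
move=> [uu vv uv].
by rewrite (hform_comb_diag (dot_hermitian_form nV)) // uu vv !mulr1.
Qed.

Let image_comb u v a b : nW (T u) (T v) = 0 ->
  nW (T (a *: u + b *: v)) (T (a *: u + b *: v)) =
  `|s a| ^+ 2 * nW (T u) (T u) + `|s b| ^+ 2 * nW (T v) (T v).
Proof.
move=> uv; rewrite TD !TZ.
by rewrite (hform_comb_diag (dot_hermitian_form nW)).
Qed.

(** [T u] and [T v] are extremal with the different values [G u u] and [G v v],
    so [G' (T u) (T v)] is both of these multiples of the inner product. *)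
Let diagonal_image u v : orthonormal2 nV u v -> G u v = 0 -> G v v < G u u ->
  nW (T u) (T v) = 0 /\ G' (T u) (T v) = 0.
Proof.
move=> uv Guv lt_vu; have [uu vv _] := uv.
have ru := hform_real hG u; have rv := hform_real hG v.
have le_vu := ltW lt_vu.
have Tuv : G' (T u) (T v) = G u u * nW (T u) (T v).
  apply: (image_of_extremal hG' TD T_plane GT) => //.
  - move=> _ [a [b ->]]; rewrite (comb_norm _ _ uv) (hform_comb_diag hG) //.
    rewrite (_ : _ - _ = `|b| ^+ 2 * (G u u - G v v)); last by ring.
    by rewrite mulr_ge0 ?exprn_ge0 // subr_ge0.
  - by rewrite uu mulr1.
  - exact: orthonormal_neq0.
have Tvu : - G' (T v) (T u) = - G v v * nW (T v) (T u).
  apply: (image_of_extremal (G := fun x y => - G x y) (hform_opp hG') TD T_plane) => //.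
  - by move=> x; rewrite !mulNr GT.
  - by rewrite rpredN.
  - move=> _ [b [a ->]]; rewrite [_ *: v + _]addrC (comb_norm _ _ uv).
    rewrite (hform_comb_diag hG) //.
    rewrite (_ : _ - _ = `|a| ^+ 2 * (G u u - G v v)); last by ring.
    by rewrite mulr_ge0 ?exprn_ge0 // subr_ge0.
  - by rewrite vv mulr1.
  - exact: orthonormal_neq0.
have {}Tvu : G' (T u) (T v) = G v v * nW (T u) (T v).
  have {Tvu} := congr1 (fun z => - z^*) Tvu.
  rewrite rmorphM !rmorphN /= -(hformC hG') -dotC (CrealP rv) => /oppr_inj.
  by rewrite mulNr => /oppr_inj.
have T0 : nW (T u) (T v) = 0.
  move/eqP: Tuv; rewrite Tvu -subr_eq0 -mulrBl mulf_eq0 subr_eq0.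
  by rewrite lt_eqF //= => /eqP.
by split=> //; rewrite Tvu T0 mulr0.
Qed.

(** The quotients at [u + k v] and at its image are averages of [G u u] and
    [G v v], with weights in the ratios [1 : |k|^2] and
    [|T u|^2 : |s k|^2 |T v|^2]. *)
Let diagonal_norms u v : orthonormal2 nV u v -> G u v = 0 -> G v v < G u u ->
  nW (T u) (T v) = 0 /\
  forall k, `|s k| ^+ 2 * nW (T v) (T v) = `|k| ^+ 2 * nW (T u) (T u).
Proof.
move=> uv Guv lt_vu; have [Tuv Guv'] := diagonal_image uv Guv lt_vu.
split=> // k; have [uu vv _] := uv.
have Gu : G' (T u) (T u) = G u u * nW (T u) (T u) by rewrite GT uu mulr1.
have Gv : G' (T v) (T v) = G v v * nW (T v) (T v) by rewrite GT vv mulr1.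
have := GT (1 *: u + k *: v).
rewrite (comb_norm _ _ uv) (image_comb _ _ Tuv) TD !TZ.
rewrite (hform_comb_diag hG) // (hform_comb_diag hG') // Gu Gv s1.
rewrite normr1 expr1n => E.
have d0 : G u u - G v v != 0 by rewrite subr_eq0 gt_eqF.
by apply: (mulfI d0); apply: (eq_by_sub E); ring.
Qed.

Let diagonal_conformal u v : orthonormal2 nV u v -> G u v = 0 -> G v v < G u u ->
  (forall k, `|s k| = `|k|) /\
  forall z, in_span2 z u v -> nW (T z) (T z) = nW (T u) (T u) * nV z z.
Proof.
move=> uv Guv lt_vu; have [Tuv H] := diagonal_norms uv Guv lt_vu.
have vu : nW (T v) (T v) = nW (T u) (T u).
  by have := H 1; rewrite s1 normr1 expr1n !mul1r.
have u0 : nW (T u) (T u) != 0.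
  rewrite dnorm_eq0; apply/eqP => /T_eq0/eqP; apply/negP.
  by case: uv => /orthonormal_neq0.
have sn k : `|s k| = `|k|.
  have := H k; rewrite vu => /(mulIf u0)/eqP.
  by rewrite eqrXn2 // => /eqP.
split=> // _ [a [b ->]]; rewrite (image_comb _ _ Tuv) (comb_norm _ _ uv) !sn vu.
by ring.
Qed.

Lemma plane_conformal x y : G x x * nV y y != G y y * nV x x ->
  (forall k, `|s k| = `|k|) /\
  nW (T x) (T x) * nV y y = nW (T y) (T y) * nV x x.
Proof.
move=> Gxy.
have x0 : x != 0.
  apply: contraNneq Gxy => ->.
  by rewrite dot0l mulr0 -(scale0r (0 : V)) (hformZl hG) !mul0r.
have xy : ~ in_span2 y x x.
  move=> /in_span2_diag[k yE]; case/eqP: Gxy.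
  by rewrite yE (hformZl hG) (hformZr hG) dotZl dotZr /=; ring.
have [u0 [v0 [uv0 xu0 yu0]]] := gram_schmidt nV x0 xy.
have [u [v [uv Guv u0u v0u]]] := diagonalize hG uv0.
have span_trans z : in_span2 z u0 v0 -> in_span2 z u v.
  by move=> [a [b ->]]; apply: in_span2D; apply: in_span2Z.
have [uu vv uv'] := uv.
have concl u' v' : (forall z, in_span2 z u v -> in_span2 z u' v') ->
   orthonormal2 nV u' v' -> G u' v' = 0 -> G v' v' < G u' u' ->
  (forall k, `|s k| = `|k|) /\
  nW (T x) (T x) * nV y y = nW (T y) (T y) * nV x x.
  move=> span_uv' ouv' Guv' lt_vu'.
  have [sn H] := diagonal_conformal ouv' Guv' lt_vu'; split=> //.
  rewrite (H x) ?(H y); [by ring|exact/span_uv'/span_trans..].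
have vu : nV v u = 0 by rewrite dotC uv' rmorph0.
case: (real_ltgtP (hform_real hG u) (hform_real hG v)) => [lt_uv|lt_vu|eq_uv].
- apply: (concl v u) => //; last by rewrite (hformC hG) Guv rmorph0.
  by move=> _ [a [b ->]]; exists b, a; rewrite addrC.
- exact: (concl u v).
have scalar z : in_span2 z u v -> G z z = G u u * nV z z.
  move=> [a [b ->]]; rewrite (comb_norm _ _ uv) (hform_comb_diag hG) // -eq_uv.
  by ring.
case/eqP: Gxy; rewrite (scalar x) ?(scalar y); [by ring|exact: span_trans..].
Qed.

End Plane.

(** A vector [z] has a quotient different from that of [x] or from that of [y],
    so its scaling factor is theirs. *)
Theorem conformal_of_quotients (C : numClosedFieldType) (V W : lmodType C)
    (nV : {dot V for conjC}) (nW : {dot W for conjC})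
    (G : V -> V -> C) (G' : W -> W -> C) (T : V -> W) (s : C -> C) :
  hermitian_form G -> hermitian_form G' ->
  {morph T : x y / x + y} -> (forall k x, T (k *: x) = s k *: T x) -> s 1 = 1 ->
  (forall z x y, in_span2 z (T x) (T y) ->
     exists2 w, in_span2 w x y & exists k, z = k *: T w) ->
  (forall x, T x = 0 -> x = 0) ->
  (forall x, G x x * nW (T x) (T x) = G' (T x) (T x) * nV x x) ->
  (exists x y, G x x * nV y y != G y y * nV x x) ->
  (forall k, `|s k| = `|k|) /\
  exists2 c, 0 < c & forall x, nW (T x) (T x) = c * nV x x.
Proof.
move=> hG hG' TD TZ s1 T_plane T_eq0 GT [x [y Gxy]].
have plane := plane_conformal hG hG' TD TZ s1 T_plane T_eq0 GT.
have [sn Txy] := plane x y Gxy; split=> //.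
have G0 : G 0 0 = 0 by rewrite -(scale0r (0 : V)) (hformZl hG) mul0r.
have x0 : x != 0.
  by apply: contraNneq Gxy => ->; rewrite dot0l mulr0 G0 mul0r.
have y0 : y != 0.
  by apply: contraNneq Gxy => ->; rewrite dot0l mulr0 G0 mul0r.
have nx0 : nV x x != 0 by rewrite dnorm_eq0.
have ny0 : nV y y != 0 by rewrite dnorm_eq0.
exists (nW (T x) (T x) / nV x x).
  rewrite divr_gt0 // dnorm_gt0 //; by apply: contraNneq x0 => /T_eq0 ->.
move=> z; apply: (mulIf nx0); rewrite mulrAC divfK //.
have [zx|/plane[_ ->//]] := eqVneq (G z z * nV x x) (G x x * nV z z).
have [zy|/plane[_ zy]] := eqVneq (G z z * nV y y) (G y y * nV z z); last first.
  apply: (mulIf ny0).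
  rewrite [LHS]mulrAC zy mulrAC [in RHS]mulrAC Txy; ring.
have [z0|z0] := eqVneq (nV z z) 0.
  move/eqP: z0; rewrite dnorm_eq0 => /eqP ->.
  have -> : T 0 = 0 by apply: (addrI (T 0)); rewrite -TD !addr0.
  by rewrite !dot0l mulr0 mul0r.
case/eqP: Gxy; apply: (mulIf z0).
rewrite mulrAC -zx mulrAC zy; ring.
Qed.

(** * Parseval's identity and traces *)

Section FiniteSubsets.
Context {R : realType} {H : hilbertType R}.
Variable E : set H.

#[global] Instance finite_subsets_proper : ProperFilter (finite_subsets E).
Proof.
apply: filter_from_proper; last first.
  by move=> X XE; exists X; split.
apply: filter_from_filter; first by exists fset0 => x.
move=> X Y XE YE; exists (X `|` Y)%fset.
  by move=> x /=; rewrite inE => /orP[/XE|/YE].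
move=> Z [XYZ ZE]; split; split=> // x xX; apply: XYZ => /=;
  by rewrite inE xX ?orbT.
Qed.

End FiniteSubsets.

Section Parseval.
Context {R : realType} {H : hilbertType R}.
Variable E : set H.
Hypothesis hE : orthonormal_basis E.
Implicit Types (X Y : {fset H}) (x y e : H).

Let E1 e : E e -> '[e, e] = 1. Proof. by case: hE => -[h _] _; exact: h. Qed.
Let E0 e f : E e -> E f -> e <> f -> '[e, f] = 0.
Proof. by case: hE => -[_ h] _; exact: h. Qed.

Definition fourier_sum x X : H := \sum_(e <- X) '[x, e] *: e.

Let coef x X e : [set` X] `<=` E -> E e ->
  '[fourier_sum x X, e] = if e \in X then '[x, e] else 0.
Proof.
move=> XE Ee; rewrite /fourier_sum linear_sumlz.
case: ifPn => eX.
  rewrite (big_fsetD1 e) //= linearZl_LR /= E1 // mulr1 big1_seq ?addr0 //.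
  move=> f; rewrite /= !inE => /andP[/eqP fe fX].
  by rewrite linearZl_LR /= (E0 (XE _ fX) Ee) ?mulr0.
rewrite big1_seq // => f /= fX; rewrite linearZl_LR /= (E0 (XE _ fX) Ee) ?mulr0 //.
by move=> fe; move: eX; rewrite -fe fX.
Qed.

Definition fourier_norm x X : R[i] := \sum_(e <- X) `|'[x, e]| ^+ 2.

Let fourier_sum_norm x X : [set` X] `<=` E ->
  '[x, fourier_sum x X] = fourier_norm x X.
Proof.
move=> XE; rewrite linear_sumr; apply: eq_bigr => e _.
by rewrite linearZr_LR /= normCK mulrC.
Qed.

Let fourier_sum_mono x X Y : [set` X] `<=` [set` Y] -> [set` Y] `<=` E ->
  '[fourier_sum x Y, fourier_sum x X] = fourier_norm x X.
Proof.
move=> XY YE; rewrite linear_sumr; apply: eq_big_seq => e eX.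
rewrite linearZr_LR /= coef //; last exact/YE/XY.
have -> : e \in Y by exact: XY.
by rewrite normCK mulrC.
Qed.

Let fourier_dist x X Y : [set` X] `<=` [set` Y] -> [set` Y] `<=` E ->
  `|fourier_sum x X - fourier_sum x Y| ^+ 2 = fourier_norm x Y - fourier_norm x X.
Proof.
move=> XY YE; have XE := subset_trans XY YE.
rewrite distrC sqr_norm_inner linearBl /= !linearBr /=.
rewrite (dotC inner (fourier_sum x X) (fourier_sum x Y)) !fourier_sum_mono //.
have -> : (fourier_norm x X)^* = fourier_norm x X.
  apply/CrealP/ger0_real; apply: sumr_ge0 => e _; exact: exprn_ge0.
by rewrite subrr subr0.
Qed.

Let bessel x X : [set` X] `<=` E -> fourier_norm x X <= `|x| ^+ 2.
Proof.
move=> XE; have r : (fourier_norm x X)^* = fourier_norm x X.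
  apply/CrealP/ger0_real; apply: sumr_ge0 => e _; exact: exprn_ge0.
rewrite -subr_ge0 -[_ - _](_ : `|x - fourier_sum x X| ^+ 2 = _) ?exprn_ge0 //.
rewrite !sqr_norm_inner linearBl /= !linearBr /= fourier_sum_mono //.
by rewrite (dotC inner (fourier_sum x X) x) fourier_sum_norm // r subrr subr0.
Qed.

Let fourier_norm_ge0 x X : 0 <= fourier_norm x X.
Proof. by apply: sumr_ge0 => e _; exact: exprn_ge0. Qed.

Let fourier_normE x X : fourier_norm x X = (complex.Re (fourier_norm x X))%:C.
Proof. by rewrite RRe_real // ger0_real. Qed.

(** The squared distance of two nested partial sums is the difference of their
    squared norms, and these are bounded by Bessel's inequality; a finite set
    with squared norm close to the supremum witnesses the Cauchy property. *)
Let fourier_cauchy x : cauchy (fourier_sum x @ finite_subsets E).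
Proof.
apply: cauchy_exP => eps eps0.
pose A := [set complex.Re (fourier_norm x X) |
  X in [set X : {fset H} | [set` X] `<=` E]].
have supA : has_sup A.
  split; first by exists (complex.Re (fourier_norm x fset0)), fset0.
  exists (complex.Re (`|x| ^+ 2)) => _ [X XE <-].
  by have := bessel x XE; rewrite lecE => /andP[].
have eps2 : eps ^+ 2 = (complex.Re (eps ^+ 2))%:C.
  by rewrite RRe_real // ger0_real // exprn_ge0 // ltW.
have r0 : 0 < complex.Re (eps ^+ 2).
  by rewrite -ltcR -eps2 exprn_gt0.
have [_ [X XE <-] XA] := sup_adherent r0 supA.
exists (fourier_sum x X), X => // Y [XY YE] /=.
rewrite -ball_normE /ball_ /=.
suff : `|fourier_sum x X - fourier_sum x Y| < eps by [].
rewrite -(@ltr_pXn2r _ 2) ?nnegrE ?(ltW eps0) //.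
rewrite [Z in Z < _](fourier_dist x XY YE).
rewrite fourier_normE [Z in _ - Z]fourier_normE eps2 -rmorphB /= ltcR.
rewrite ltrBlDr addrC -ltrBlDr.
apply: (le_lt_trans _ XA); rewrite lerD2r; apply: sup_ubound; last by exists Y.
by case: supA.
Qed.

Lemma inner_cvg (I : Type) (F : set_system I) (f : I -> H) (p z : H) :
  Filter F -> f @ F --> p ->
  (fun i => '[f i, z] : R[i]^o) @ F --> ('[p, z] : R[i]^o).
Proof.
move=> FF /cvgrPdist_lt fp; apply/cvgrPdist_lt => eps eps0.
have z1 : 0 < `|z| + 1 by rewrite ltr_wpDl.
have := fp (eps / (`|z| + 1)); rewrite divr_gt0 // => /(_ isT).
apply: filterS => i; rewrite -linearBl /= ltr_pdivlMr // => h.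
apply: le_lt_trans h.
have cs := cauchy_schwarz inner (p - f i) z.
have : `|'[p - f i, z]| <= `|p - f i| * `|z|.
  by rewrite -(@ler_pXn2r _ 2) ?nnegrE ?mulr_ge0 // exprMn !sqr_norm_inner.
by move=> /le_trans; apply; rewrite ler_wpM2l // lerDl.
Qed.

(** The limit [p] has the same coefficients as [x], and a nonzero [x - p] could be
    normalized and added to the maximal orthonormal set. *)
Lemma fourier_cvg x : fourier_sum x @ finite_subsets E --> x.
Proof.
have /cauchy_cvg/cvg_ex[p xp] := fourier_cauchy x.
suff {2}-> : x = p by [].
have coefp e : E e -> '[p, e] = '[x, e].
  move=> Ee; have h := inner_cvg (z := e) _ xp.
  apply: (@norm_cvg_unique _ R[i]^o _ _ _ _ (h _)) => //.
  apply: cvg_near_cst; exists [fset e]%fset.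
    by move=> f /=; rewrite inE => /eqP ->.
  move=> X [eX XE] /=; rewrite coef // ifT //; apply: eX.
  by rewrite /= inE.
apply/eqP; rewrite -subr_eq0; apply/negPn/negP => d0.
pose u := (sqrtC '[x - p, x - p])^-1 *: (x - p).
have u1 : '[u, u] = 1 by exact: normalize.
have uE e : E e -> '[u, e] = 0.
  by move=> Ee; rewrite linearZl_LR /= (linearBl _ e) /= coefp // subrr mulr0.
have uNE : ~ E u.
  by move=> /uE/eqP; rewrite u1 oner_eq0.
case: hE => _ /(_ (E `|` [set u])); apply.
  by split=> [e|h]; [left|apply: uNE; apply: h; right].
split=> [e [/E1//|->//]|e f [Ee|->] [Ef|->]] //.
- exact: E0.
- by rewrite dotC uE // rmorph0.
- by rewrite uE.
Qed.

Lemma parseval x y :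
  (fun X : {fset H} => \sum_(e <- X) '[x, e] * '[e, y] : R[i]^o) @ finite_subsets E
    --> ('[x, y] : R[i]^o).
Proof.
rewrite [X in X @ _ --> _](_ : _ = fun X => '[fourier_sum x X, y]).
  exact: (inner_cvg (f := fourier_sum x) _ (@fourier_cvg x)).
apply/funext => X; rewrite linear_sumlz; apply: eq_bigr => e _.
by rewrite linearZl_LR.
Qed.

End Parseval.

Section RankOne.
Context {R : realType} {H : hilbertType R}.
Implicit Types (x y : H) (T D : H -> H).

(** The orthogonal projection onto the line of [y], and zero for [y = 0]. *)
Definition rank1 y x : H := ('[x, y] / '[y, y]) *: y.

Lemma positive_hermitian D : positive_operator D ->
  hermitian_form (fun x y => '[D x, y]).
Proof.
move=> [[linD _] D0].
have DD x y : D (x + y) = D x + D y.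
  by have := linD 1 x y; rewrite !scale1r.
have DZ a x : D (a *: x) = a *: D x.
  have D00 : D 0 = 0 by apply: (addrI (D 0)); rewrite -DD !addr0.
  by have := linD a x 0; rewrite D00 !addr0.
split=> [x y z|a x y|x y]; first by rewrite DD linearDl.
  by rewrite DZ dotZl.
apply/eqP; rewrite -subr_eq0; apply/eqP.
apply: (@sesquilinear_eq0 _ _ (fun x y => '[D x, y] - ('[D y, x])^*)).
- by move=> {x y} x y z; rewrite DD linearDl linearDr rmorphD /=; ring.
- by move=> {x y} x y z; rewrite DD linearDl linearDr rmorphD /=; ring.
- by move=> {x y} a x y; rewrite DZ dotZl dotZr rmorphM /= conjCK; ring.
- by move=> {x y} a x y; rewrite DZ dotZl dotZr rmorphM /=; ring.
- by move=> {x y} x; rewrite (CrealP (ger0_real (D0 x))) subrr.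
Qed.

(** The diagonal entries are the terms of Parseval's identity for
    [x / <x, x>] and [D x].  At [x = 0] both sides vanish. *)
Lemma trace_rank1 D x : positive_operator D ->
  trace (rank1 x \o D) = '[D x, x] / '[x, x].
Proof.
move=> posD; have hD := positive_hermitian posD.
have h := @parseval _ _ _ (@hilbert_basisP R H) (('[x, x])^-1 *: x) (D x).
have := cvg_lim (@norm_hausdorff R[i] R[i]^o) h.
rewrite dotZl /= mulrC.
have -> : '[x, D x] = '[D x, x] by rewrite dotC -(hformC hD).
move=> <-; rewrite /trace.
apply: (congr1 (fun f : {fset H} -> R[i]^o =>
  lim (f @ finite_subsets (hilbert_basis H)))).
apply/funext => X; apply: eq_bigr => e _ /=.
rewrite /rank1 !dotZl /= (hformC hD e x) -dotC; ring.
Qed.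

End RankOne.

(** * Projections and their order *)

Section Projections.
Context {R : realType} {H : hilbertType R}.
Implicit Types (x y z w : H) (P Q : projection H).

Lemma projD P x y : P (x + y) = P x + P y.
Proof. by case: P => T [[lin _] _ _] /=; have := lin 1 x y; rewrite !scale1r. Qed.

Lemma projZ P a x : P (a *: x) = a *: P x.
Proof.
have P0 : P 0 = 0 by apply: (addrI (P 0)); rewrite -projD !addr0.
case: P P0 => T [[lin _] _ _] /= T0.
by have := lin a x 0; rewrite T0 !addr0.
Qed.

Lemma projB P x y : P (x - y) = P x - P y.
Proof. by rewrite projD -scaleN1r projZ scaleN1r. Qed.

Lemma proj_idem P x : P (P x) = P x.
Proof. by case: P => T [_ _ TT] /=; exact: (congr1 (fun f => f x) TT). Qed.

Lemma proj_sym P x y : '[P x, y] = '[x, P y].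
Proof. by case: P => T [_ sym _] /=; exact: sym. Qed.

Lemma inner_proj P x : '[P x, x] = '[P x, P x].
Proof. by rewrite -proj_sym proj_idem. Qed.

Lemma pythagoras x y : '[x - y, y] = 0 -> '[x, x] = '[x - y, x - y] + '[y, y].
Proof. by move=> xy; rewrite -hnormDd // subrK. Qed.

(** By Pythagoras, a symmetric idempotent map does not increase norms, so it is
    bounded. *)
Lemma is_projectionI (T : H -> H) :
  (forall x y, T (x + y) = T x + T y) -> (forall a x, T (a *: x) = a *: T x) ->
  adjoint_pair T T -> (forall x, T (T x) = T x) -> is_projection T.
Proof.
move=> TD TZ sym idem; split=> //; last exact/funext.
split; first by move=> a x y; rewrite TD TZ.
exists 1 => x; rewrite mul1r -(@ler_pXn2r _ 2) ?nnegrE // !sqr_norm_inner.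
rewrite (@pythagoras x (T x)) ?lerDr ?dnorm_ge0 //.
by rewrite linearBl /= sym idem subrr.
Qed.

(** Inclusion of ranges, the range of a projection being its set of fixed
    vectors. *)
Definition proj_le P Q := forall x, P x = x -> Q x = x.

(** If [P <= Q] and [P x = x], then [|Q x| >= |x|], which forces [Q x = x] by
    Pythagoras.  Conversely, inclusion of ranges makes [Q - P] a projection. *)
Lemma operator_leP P Q : operator_le P Q <-> proj_le P Q.
Proof.
split=> [[_ PQ] x Px|PQ].
  have := PQ x; rewrite linearBl /= inner_proj Px subr_ge0 => le_xQ.
  have := @pythagoras x (Q x).
  rewrite linearBl /= proj_sym proj_idem -proj_sym inner_proj subrr => /(_ erefl).
  move=> xE; move: le_xQ; rewrite {1}xE gerDr => le0.
  apply/esym/eqP; rewrite -subr_eq0 -(dnorm_eq0 inner).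
  by rewrite eq_le le0 dnorm_ge0.
have QP x : Q (P x) = P x by apply/PQ/proj_idem.
have PQx x : P (Q x) = P x.
  apply/eqP; rewrite -subr_eq0 -(dnorm_eq0 inner) -projB.
  by rewrite proj_sym proj_idem -[P _]QP -proj_sym projB proj_idem subrr dot0l.
have [bdd _ _] : is_projection (fun x => Q x - P x).
  apply: is_projectionI => [x y|a x|x y|x].
  - by rewrite !projD opprD addrACA.
  - by rewrite !projZ scalerBr.
  - by rewrite linearBl linearBr /= !proj_sym.
  - by rewrite !projB !proj_idem QP PQx subrr subr0.
split=> // x; rewrite -[X in 0 <= inner X x]/((fun x => Q x - P x) x).
have -> : '[Q x - P x, x] = '[Q x - P x, Q x - P x].
  rewrite [RHS]linearBr /= -!proj_sym !projB !proj_idem QP PQx.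
  by rewrite subrr dot0l subr0.
exact: dnorm_ge0.
Qed.

Lemma proj_char P y w : P w = w -> (forall z, P z = z -> '[y - w, z] = 0) -> P y = w.
Proof.
move=> Pw yw; apply/eqP; rewrite -subr_eq0 -{1}Pw -projB -(dnorm_eq0 inner).
by rewrite proj_sym yw ?proj_idem.
Qed.

Lemma proj_leA P Q : proj_le P Q -> proj_le Q P -> P = Q.
Proof.
move=> PQ QP; apply/projection_eqP => x; apply: proj_char.
  exact/QP/proj_idem.
move=> z /PQ Qz; rewrite linearBl /= -{2}Qz -proj_sym.
by rewrite proj_idem proj_sym Qz subrr.
Qed.

Lemma rank1D y x x' : rank1 y (x + x') = rank1 y x + rank1 y x'.
Proof. by rewrite /rank1 linearDl /= mulrDl scalerDl. Qed.

Lemma rank1Z y a x : rank1 y (a *: x) = a *: rank1 y x.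
Proof. by rewrite /rank1 dotZl /= scalerA mulrA. Qed.

Lemma rank1_id y : rank1 y y = y.
Proof.
have [->|y0] := eqVneq y 0; first by rewrite /rank1 scaler0.
by rewrite /rank1 divff ?scale1r // dnorm_eq0.
Qed.

Lemma rank1_idem y x : rank1 y (rank1 y x) = rank1 y x.
Proof. by rewrite {2 3}/rank1 rank1Z rank1_id. Qed.

Lemma rank1_sym y : adjoint_pair (rank1 y) (rank1 y).
Proof.
move=> x z; rewrite /rank1 dotZl dotZr /= rmorphM fmorphV /=.
by rewrite -!dotC; ring.
Qed.

Definition rank1_proj y : projection H :=
  Projection (is_projectionI (rank1D y) (rank1Z y) (@rank1_sym y) (rank1_idem y)).

Lemma rank1_fix y x : rank1 y x = x <-> exists a, x = a *: y.
Proof.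
split=> [<-|[a ->]]; first by exists ('[x, y] / '[y, y]).
by rewrite rank1Z rank1_id.
Qed.

Lemma rank1_proj_le y P : proj_le (rank1_proj y) P <-> P y = y.
Proof.
split=> [|Py x /= /rank1_fix[a ->]]; last by rewrite projZ Py.
by apply; exact: rank1_id.
Qed.

(** The orthogonal projection onto the span of [y] and [z], by orthogonalizing
    [z] against [y]. *)
Definition rank2 y z x : H := rank1 y x + rank1 (z - rank1 y z) x.

Section RankTwo.
Variables y z : H.
Let z' := z - rank1 y z.

Let yz' : '[y, z'] = 0.
Proof. by rewrite /z' linearBr /= -rank1_sym rank1_id subrr. Qed.

Let rank1_yz' x : rank1 y (rank1 z' x) = 0.
Proof.
by rewrite /rank1 dotZl /= (dotC inner z' y) yz' rmorph0 mulr0 mul0r scale0r.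
Qed.

Let rank1_z'y x : rank1 z' (rank1 y x) = 0.
Proof. by rewrite /rank1 dotZl /= yz' mulr0 mul0r scale0r. Qed.

Let rank2D x x' : rank2 y z (x + x') = rank2 y z x + rank2 y z x'.
Proof. by rewrite /rank2 !rank1D addrACA. Qed.

Let rank2Z a x : rank2 y z (a *: x) = a *: rank2 y z x.
Proof. by rewrite /rank2 !rank1Z scalerDr. Qed.

Let rank2_sym : adjoint_pair (rank2 y z) (rank2 y z).
Proof. by move=> x x'; rewrite linearDl linearDr /= !rank1_sym. Qed.

Let rank2_idem x : rank2 y z (rank2 y z x) = rank2 y z x.
Proof.
rewrite [X in rank2 _ _ X]/rank2 -/z' rank2D /rank2 -/z'.
by rewrite !rank1_idem rank1_yz' rank1_z'y addr0 add0r.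
Qed.

Definition rank2_proj : projection H :=
  Projection (is_projectionI rank2D rank2Z rank2_sym rank2_idem).

Lemma rank2_fix x : rank2_proj x = x <-> in_span2 x y z.
Proof.
split=> [<-|[a [b ->]]] /=.
  exists ('[x, y] / '[y, y] - '[x, z'] / '[z', z'] * ('[z, y] / '[y, y])),
    ('[x, z'] / '[z', z']).
  have zE : rank1 z' x = ('[x, z'] / '[z', z']) *: (z - ('[z, y] / '[y, y]) *: y) by [].
  by rewrite /rank2 -/z' zE scalerBr scalerBl scalerA [_ *: z - _]addrC addrA.
have fy : rank2 y z y = y.
  by rewrite /rank2 -/z' rank1_id -{2}(rank1_id y) rank1_z'y addr0.
have fz : rank2 y z z = z.
  rewrite /rank2 -/z' -[in X in _ + rank1 _ X](subrK (rank1 y z) z) -/z'.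
  by rewrite rank1D rank1_z'y rank1_id addr0 /z' addrC subrK.
by rewrite rank2D !rank2Z fy fz.
Qed.

End RankTwo.

(** Three independent vectors do not fit in a plane: the 3 by 2 matrix of their
    coordinates would have a nonzero left kernel. *)
Lemma ex_not_in_span2 : dim_ge H 3 -> forall x y, exists z, ~ in_span2 z x y.
Proof.
move=> [v vfree] x y; apply/not_existsP => all_span.
have /choice[f fE] : forall i : 'I_3, exists ab : R[i] * R[i],
    v i = ab.1 *: x + ab.2 *: y.
  move=> i; have /contrapT[a [b ab]] := all_span (v i).
  by exists (a, b).
pose A : 'M[R[i]]_(3, 2) := \matrix_(i, j) (if j == 0 then (f i).1 else (f i).2).
have : kermx A != 0.
  by rewrite -mxrank_eq0 mxrank_ker subn_eq0 -ltnNge ltnS rank_leq_col.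
move=> /rowV0Pn[c /sub_kermxP cA c0].
case/eqP: c0; apply/rowP => i; rewrite mxE; apply: vfree i.
transitivity (\sum_i ((c 0 i * (f i).1) *: x + (c 0 i * (f i).2) *: y)).
  by apply: eq_bigr => i _; rewrite fE scalerDr !scalerA.
rewrite big_split /= -!scaler_suml.
have := congr1 (fun M : 'rV_2 => M 0 0) cA; have := congr1 (fun M : 'rV_2 => M 0 1) cA.
rewrite !mxE => E1 E2.
have -> : \sum_i c 0 i * (f i).1 = 0.
  by rewrite -[RHS]E2; apply: eq_bigr => i _; rewrite mxE.
have -> : \sum_i c 0 i * (f i).2 = 0.
  by rewrite -[RHS]E1; apply: eq_bigr => i _; rewrite mxE.
by rewrite !scale0r addr0.
Qed.

End Projections.

(** * The collineation of an order automorphism *)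

Section OrderAutomorphism.
Context {R : realType} {H : hilbertType R}.
Implicit Types (x y z w : H) (P Q : projection H).
Variable phi : projection H -> projection H.
Hypothesis phi_bij : bijective phi.
Hypothesis phi_le : forall P Q, proj_le P Q <-> proj_le (phi P) (phi Q).

Let phi_surj Q : exists P, phi P = Q.
Proof. by case: phi_bij => g _ gK; exists (g Q). Qed.

Let phi_mono P Q : proj_le P Q -> proj_le (phi P) (phi Q).
Proof. exact: (phi_le P Q).1. Qed.

Let phi_reflect P Q : proj_le (phi P) (phi Q) -> proj_le P Q.
Proof. exact: (phi_le P Q).2. Qed.

Let proj0_le Q : proj_le (rank1_proj 0) Q.
Proof. by apply/rank1_proj_le; rewrite -(scale0r (0 : H)) projZ !scale0r. Qed.

Let phi0 : phi (rank1_proj 0) = rank1_proj 0.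
Proof.
apply: proj_leA; last exact: proj0_le.
by have [P PE] := phi_surj (rank1_proj 0); rewrite -{2}PE; exact/phi_mono/proj0_le.
Qed.

Let ex_fix P : P <> rank1_proj 0 -> exists2 x, x <> 0 & P x = x.
Proof.
move=> P0; apply: contrapT => no; apply: P0; apply: proj_leA => //.
move=> x Px; have -> : x = 0 by apply: contrapT => x0; apply: no; exists x.
exact: rank1_id.
Qed.

Let rank1_neq0 x : x <> 0 -> rank1_proj x <> rank1_proj 0.
Proof.
move=> x0 E; apply: x0; rewrite -(rank1_id x).
by rewrite -[rank1 x x]/(rank1_proj x x) E /= /rank1 scaler0.
Qed.

(** A line [w] below [phi (rank1_proj x)] is the image of some nonzero [P] below
    [rank1_proj x]; such a [P] is [rank1_proj x] itself. *)
Let phi_atom x : exists w, phi (rank1_proj x) = rank1_proj w.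
Proof.
have [->|/eqP x0] := eqVneq x 0; first by exists 0.
have phi_inj := bij_inj phi_bij.
have /ex_fix[w w0 Qw] : phi (rank1_proj x) <> rank1_proj 0.
  by rewrite -phi0 => /phi_inj; exact: rank1_neq0.
exists w; have [P Pw] := phi_surj (rank1_proj w).
have wQ : proj_le (rank1_proj w) (phi (rank1_proj x)) by apply/rank1_proj_le.
apply: proj_leA => //; rewrite -Pw; apply/phi_mono/rank1_proj_le.
have /ex_fix[y y0 Py] : P <> rank1_proj 0.
  by move=> P0; case: (rank1_neq0 w0); rewrite -Pw P0.
have /rank1_fix[a yx] : rank1 x y = y by rewrite -Pw in wQ; exact: (phi_reflect wQ).
have a0 : a != 0.
  by apply/eqP => a0; apply: y0; rewrite yx a0 scale0r.
by apply: (scalerI a0); rewrite -projZ -yx.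
Qed.

Definition ray_map x : H := if x == 0 then 0 else projT1 (cid (phi_atom x)).

Lemma ray_map0 : ray_map 0 = 0. Proof. by rewrite /ray_map eqxx. Qed.

Lemma phi_rank1 x : phi (rank1_proj x) = rank1_proj (ray_map x).
Proof.
rewrite /ray_map; case: eqVneq => [->//|_]; exact: (projT2 (cid (phi_atom x))).
Qed.

Lemma phi_fix P x : P x = x <-> phi P (ray_map x) = ray_map x.
Proof.
split=> [/rank1_proj_le/phi_mono|h]; first by rewrite phi_rank1 => /rank1_proj_le.
by apply/rank1_proj_le/phi_reflect; rewrite phi_rank1; apply/rank1_proj_le.
Qed.

Lemma ray_map_eq0 x : ray_map x = 0 -> x = 0.
Proof.
move=> px; have /(phi_fix _ _).2 : phi (rank1_proj 0) (ray_map x) = ray_map x.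
  by rewrite px phi0 /= rank1_id.
by rewrite /= /rank1 scaler0 => <-.
Qed.

Lemma ray_map_surj w : exists x a, w = a *: ray_map x.
Proof.
have [->|/eqP w0] := eqVneq w 0; first by exists 0, 0; rewrite scale0r.
have [P Pw] := phi_surj (rank1_proj w).
have /ex_fix[x x0 Px] : P <> rank1_proj 0.
  by move=> P0; case: (rank1_neq0 w0); rewrite -Pw P0.
move/(phi_fix _ _).1: Px; rewrite Pw => /rank1_fix[b xb]; exists x, b^-1.
rewrite xb scalerA mulVf ?scale1r //; apply/eqP => b0.
by apply: x0; apply: ray_map_eq0; rewrite xb b0 scale0r.
Qed.

(** A projection fixes a plane as soon as it fixes two spanning vectors, and
    [rank2_proj] fixes nothing else. *)
Lemma ray_map_span x y z :
  in_span2 x y z <-> in_span2 (ray_map x) (ray_map y) (ray_map z).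
Proof.
split=> xyz.
  have [P PE] := phi_surj (rank2_proj (ray_map y) (ray_map z)).
  have Py : P y = y.
    by apply/(phi_fix _ _).2; rewrite PE; apply/rank2_fix/in_span2_mem1.
  have Pz : P z = z.
    by apply/(phi_fix _ _).2; rewrite PE; apply/rank2_fix/in_span2_mem2.
  apply/rank2_fix; rewrite -PE; apply/(phi_fix _ _).1.
  by case: xyz => a [b ->]; rewrite projD !projZ Py Pz.
apply/rank2_fix/(phi_fix _ _).2; case: xyz => a [b ->]; rewrite projD !projZ.
have -> : phi (rank2_proj y z) (ray_map y) = ray_map y.
  by apply/(phi_fix _ _).1/rank2_fix/in_span2_mem1.
suff -> : phi (rank2_proj y z) (ray_map z) = ray_map z by [].
by apply/(phi_fix _ _).1/rank2_fix/in_span2_mem2.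
Qed.

End OrderAutomorphism.

(** * Semilinear isometries *)

Section Isometry.
Context {R : realType} {H : hilbertType R}.
Variables (U : H -> H) (s : R[i] -> R[i]).
Hypotheses (UD : {morph U : x y / x + y}) (UZ : forall k x, U (k *: x) = s k *: U x).
Hypothesis U_norm : forall x, '[U x, U x] = '[x, x].

Lemma additiveB x y : U (x - y) = U x - U y.
Proof.
have U0 : U 0 = 0 by apply: (addrI (U 0)); rewrite -UD !addr0.
suff -> : U (x - y) = U x + U (- y).
  by congr (_ + _); apply/eqP; rewrite -addr_eq0 -UD addNr U0.
exact: UD.
Qed.

Lemma isometry_inj : injective U.
Proof.
move=> x y Uxy; apply/eqP; rewrite -subr_eq0 -(dnorm_eq0 inner) -U_norm.
by rewrite additiveB Uxy subrr dot0l.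
Qed.

Lemma isometry_inner : (forall k, s k = k) -> forall x y, '[U x, U y] = '[x, y].
Proof.
move=> sE x y; apply/eqP; rewrite -subr_eq0; apply/eqP.
apply: (@sesquilinear_eq0 _ _ (fun x y => '[U x, U y] - '[x, y])) => {x y}.
- by move=> x y z; rewrite UD !linearDl /=; ring.
- by move=> x y z; rewrite UD !linearDr /=; ring.
- by move=> a x y; rewrite UZ sE !dotZl /=; ring.
- by move=> a x y; rewrite UZ sE !dotZr /=; ring.
- by move=> x; rewrite U_norm subrr.
Qed.

Lemma anti_isometry_inner : (forall k, s k = k^*) ->
  forall x y, '[U x, U y] = '[y, x].
Proof.
move=> sE x y; apply/eqP; rewrite -subr_eq0; apply/eqP.
apply: (@sesquilinear_eq0 _ _ (fun y x => '[U x, U y] - '[y, x])) => {x y}.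
- by move=> x y z; rewrite UD linearDl linearDr /=; ring.
- by move=> x y z; rewrite UD linearDl linearDr /=; ring.
- by move=> a x y; rewrite UZ sE dotZl dotZr /= conjCK; ring.
- by move=> a x y; rewrite UZ sE dotZl dotZr /=; ring.
- by move=> x; rewrite U_norm subrr.
Qed.

End Isometry.

(** * Order automorphisms that preserve a nonscalar state *)

(** If the quotient had a constant value [a], the form of [D - a] would vanish on
    the diagonal, so that [D = a] by polarization. *)
Lemma not_scalar_form (R : realType) (H : hilbertType R) (D : H -> H) (e : H) :
  positive_operator D -> ~ scalar_operator D -> e != 0 ->
  exists x y, '[D x, x] * '[y, y] != '[D y, y] * '[x, x].
Proof.
move=> posD nscal e0; have hD := positive_hermitian posD.
apply: contrapT => no; apply: nscal.
have xy x y : '[D x, x] * '[y, y] = '[D y, y] * '[x, x].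
  by apply/eqP/negPn/negP => h; apply: no; exists x, y.
have n0 : '[e, e] != 0 by rewrite dnorm_eq0.
pose a := '[D e, e] / '[e, e]; exists a => x.
suff D0 y : '[D x, y] - a * '[x, y] = 0.
  apply/eqP; rewrite -subr_eq0 -(dnorm_eq0 inner); apply/eqP.
  by rewrite (linearBl _ (D x - a *: x)) linearZl_LR; exact: D0.
move: x y; have hi := dot_hermitian_form (@inner R H); apply: sesquilinear_eq0.
- by move=> x y z; rewrite (hformDl hD) linearDl /=; ring.
- by move=> x y z; rewrite !(hformDr hi); ring.
- move=> b x y; rewrite (hformZl hD) (hformZl hi); ring.
- by move=> b x y; rewrite !(hformZr hi); ring.
- move=> x; apply/eqP; rewrite subr_eq0; apply/eqP; apply: (mulIf n0).
  by rewrite xy /a mulrAC divfK.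
Qed.

Theorem theorem2 (R : realType) (H : hilbertType R)
    (phi : projection H -> projection H) (D D' : H -> H) :
  dim_ge H 3 ->
  bijective phi ->
  (forall P Q : projection H,
     operator_le P Q <-> operator_le (phi P) (phi Q)) ->
  state D -> state D' ->
  ~ scalar_operator D ->
  (forall P : projection H, trace (phi P \o D') = trace (P \o D)) ->
  exists U Uadj : H -> H,
    (unitary U Uadj \/ antiunitary U Uadj) /\
    forall P : projection H, (phi P : H -> H) = U \o P \o Uadj.
Proof.
have hi := dot_hermitian_form (@inner R H).
move=> dim3 phi_bij phi_ole [posD _ _] [posD' _ _] nscalD traceD.
have phi_le P Q : proj_le P Q <-> proj_le (phi P) (phi Q).
  by split=> h; apply/operator_leP; [apply/(phi_ole P Q).1|apply/(phi_ole P Q).2];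
    exact/operator_leP.
pose p := ray_map phi_bij phi_le.
have p0 : p 0 = 0 by exact: ray_map0.
have [T [s [[sD sM s1] [TD TZ Tp]]]] :=
  fundamental_theorem_projective_geometry p0 (ray_map_span phi_bij phi_le)
    (ex_not_in_span2 dim3).
have T_eq0 x : T x = 0 -> x = 0.
  have [c c0 ->] := Tp x; move=> /eqP; rewrite scaler_eq0 (negPf c0) => /eqP.
  exact: ray_map_eq0.
have T_surj w : exists x a, w = a *: T x.
  have [x [a ->]] := ray_map_surj phi_bij phi_le w.
  have [c c0 Tx] := Tp x; exists x, (a / c).
  by rewrite Tx scalerA divfK.
(* The trace condition for the projection onto the line of [x]. *)
have GT x : '[D x, x] * '[T x, T x] = '[D' (T x), T x] * '[x, x].
  have [->|x0] := eqVneq x 0.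
    have -> : T 0 = 0 by apply: (addrI (T 0)); rewrite -TD !addr0.
    by rewrite (dot0r inner (0 : H)) !mulr0.
  have := traceD (rank1_proj x); rewrite (phi_rank1 phi_bij phi_le).
  rewrite !trace_rank1 // => tr.
  have [c c0 ->] := Tp x; rewrite -/p in tr *.
  have px0 : '[p x, p x] != 0.
    by rewrite dnorm_eq0; apply: contraNneq x0 => /ray_map_eq0 ->.
  have nx0 : '[x, x] != 0 by rewrite dnorm_eq0.
  rewrite (hformZl (positive_hermitian posD')) (hformZl hi) !(hformZr hi).
  have : '[D x, x] * '[p x, p x] = '[D' (p x), p x] * '[x, x].
    by move/eqP: tr; rewrite eqr_div // => /eqP; rewrite mulrC => <-; rewrite mulrC.
  by move=> E; apply: (eq_by_sub (congr1 (fun z => c * c^* * z) E)); ring.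
have T_plane z x y : in_span2 z (T x) (T y) ->
    exists2 w, in_span2 w x y & exists k, z = k *: T w.
  have [w [a ->]] := T_surj z; have [->|a0] := eqVneq a 0.
    exists 0; last by exists 0; rewrite !scale0r.
    by exists 0, 0; rewrite !scale0r addr0.
  move=> h; exists w; last by exists a.
  apply/(ray_map_span phi_bij phi_le).
  have {h} : in_span2 (T w) (T x) (T y).
    by rewrite -[T w](scalerK a0); exact: in_span2Z.
  have [[c c0 ->] [d d0 ->] [e e0 ->]] := And3 (Tp w) (Tp x) (Tp y).
  move=> [b [b' E]]; exists (b * d / c), (b' * e / c).
  apply: (scalerI c0); rewrite scalerDr !scalerA E !scalerA.
  by congr (_ *: _ + _ *: _); field.
have [e e0] : exists e : H, e != 0.
  have [e eN] := ex_not_in_span2 dim3 0 0; exists e.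
  by apply/eqP => eE; apply: eN; rewrite eE; exact: in_span2_mem1.
have [sn [c c0 Tc]] := conformal_of_quotients (positive_hermitian posD)
  (positive_hermitian posD') TD TZ s1 T_plane T_eq0 GT
  (not_scalar_form posD nscalD e0).
have s_cases := isometric_endomorphism sD sM s1 sn.
have s_invol k : s (s k) = k by case: s_cases => sE; rewrite !sE // conjCK.
(* [T] multiplies norms by [sqrtC c]. *)
pose r := (sqrtC c)^-1; pose U x := r *: T x.
have r0 : r != 0 by rewrite invr_eq0 sqrtC_eq0 gt_eqF.
have UD : {morph U : x y / x + y} by move=> x y; rewrite /U TD scalerDr.
have UZ k x : U (k *: x) = s k *: U x by rewrite /U TZ !scalerA mulrC.
have U_norm x : '[U x, U x] = '[x, x].
  rewrite dnormZ normfV ger0_norm ?sqrtC_ge0 ?ltW // exprVn sqrtCK Tc.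
  by rewrite mulKf // gt_eqF.
have U_surj w : exists x, U x = w.
  have [x [a ->]] := T_surj w; exists (s (a / r) *: x).
  by rewrite UZ s_invol /U scalerA divfK.
have U_inj := isometry_inj UD U_norm.
have [V VK] := choice U_surj.
have UK x : V (U x) = x by apply: U_inj.
have norm_U x : `|U x| = `|x|.
  by apply/eqP; rewrite -(@eqrXn2 _ 2) // !sqr_norm_inner U_norm.
have U_ortho x y : '[x, y] = 0 -> '[U x, U y] = 0.
  move=> xy; case: s_cases => sE.
    by rewrite (isometry_inner UD UZ U_norm sE).
  by rewrite (anti_isometry_inner UD UZ U_norm sE) dotC xy rmorph0.
(* [U] maps the range of [P] onto the range of [phi P]. *)
have U_fix (P : projection H) x : P x = x <-> phi P (U x) = U x.
  have [b b0 Ux] : exists2 b, b != 0 & U x = b *: p x.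
    by have [b b0 Tx] := Tp x; exists (r * b); rewrite ?mulf_neq0 // /U Tx scalerA.
  have fixP := phi_fix phi_bij phi_le P x.
  rewrite Ux projZ; split=> [/fixP.1 -> //|/(scalerI b0) h]; exact/fixP.2.
exists U, V; split; last first.
  (* [U (P x)] lies in the range of [phi P], and [U x - U (P x)] is orthogonal
     to that range. *)
  move=> P; apply/funext => y /=; rewrite -{1}(VK y).
  apply: proj_char; first exact/(U_fix _ _).1/proj_idem.
  move=> z; rewrite -(VK z) => /(U_fix _ _).2 Pz.
  rewrite -(additiveB UD).
  by apply: U_ortho; rewrite linearBl /= -{2}Pz -proj_sym proj_idem proj_sym Pz subrr.
case: s_cases => sE; [left|right]; split=> //.
- split; first by move=> a x y; rewrite UD UZ sE.
  by exists 1 => x; rewrite mul1r norm_U.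
- by move=> x y; rewrite -{1}(VK y) (isometry_inner UD UZ U_norm sE).
- by move=> a x y; rewrite UD UZ sE.
Qed.
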